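(* There exists an analytic function $g\colon\mathbb{D}\to\mathbb{C}$ such that the operator $T_g$ is bounded on $H^\infty(\mathbb{D})$ and $$\int_{-1}^0 |g'(x)|\,dx=+\infty,$$ where the integration is along the radius $(-1,0]$ of $\mathbb{D}$.
   Context: $\mathbb{D}$ is the open unit disk in $\mathbb{C}$, $H(\mathbb{D})$ is the set of analytic functions on $\mathbb{D}$, and $H^\infty(\mathbb{D})$ is the space of bounded analytic functions on $\mathbb{D}$ with the supremum norm. For $g\in H(\mathbb{D})$, the operator $T_g\colon H(\mathbb{D})\to H(\mathbb{D})$ is defined by $T_gf(w)=\int_0^w f(t)g'(t)\,dt$ for $f\in H(\mathbb{D})$, $w\in\mathbb{D}$. ''$T_g$ is bounded on $H^\infty(\mathbb{D})$'' means that there is a constant $C$ with $\|T_gf\|_\infty\le C\|f\|_\infty$ for all $f\in H^\infty(\mathbb{D})$. *)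

(* Defs.v *)
From Stdlib Require Import Reals.
From Coquelicot Require Import Coquelicot.

Open Scope R_scope.

Definition unit_disk (z : C) : Prop := Cmod z < 1.

(* Analytic means complex differentiable at every point of the open disk: the
   scalars are [C_AbsRing], not [R_AbsRing].  An element of H(D) is represented
   by a total function on C whose values outside the disk are never used. *)
Definition analytic_on_disk (f : C -> C) : Prop :=
  forall z : C, unit_disk z -> @ex_derive C_AbsRing C_NormedModule f z.

Definition bounded_on_disk (f : C -> C) : Prop :=
  exists M : R, forall z : C, unit_disk z -> Cmod (f z) <= M.

Definition H_infty (f : C -> C) : Prop :=
  analytic_on_disk f /\ bounded_on_disk f.

(* Valued in [Rbar]: it is [p_infty] when f is unbounded on the disk. *)
Definition sup_norm (f : C -> C) : Rbar :=
  Lub_Rbar (fun r : R => exists z : C, unit_disk z /\ r = Cmod (f z)).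

(* The integral of h(t) dt from 0 to w, along the segment t = s w with
   0 <= s <= 1.  The disk is simply connected, so for h analytic on it any other
   path in the disk from 0 to w gives the same value. *)
Definition segment_integral (h : C -> C) (w : C) : C :=
  @RInt C_R_CompleteNormedModule
    (fun s : R => Cmult (h (Cmult (RtoC s) w)) w) 0 1.

(* [C_derive] is a total operator; it is the complex derivative wherever g is
   complex differentiable ([is_C_derive_unique]), hence on the whole disk for g
   analytic there. *)
Definition T (g f : C -> C) (w : C) : C :=
  segment_integral (fun t : C => Cmult (f t) (C_derive g t)) w.

Definition T_bounded_on_H_infty (g : C -> C) : Prop :=
  exists K : R, forall f : C -> C, H_infty f ->
    Rbar_le (sup_norm (T g f)) (Rbar_mult (Finite K) (sup_norm f)).

(* The integral of phi over (-1, 0] equals +oo, as an improper integral at -1.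
   For phi nonnegative and continuous on (-1, 0] this is the same as its
   Lebesgue integral being infinite. *)
Definition integral_m1_0_infinite (phi : R -> R) : Prop :=
  filterlim (fun r : R => RInt phi r 0) (at_right (-1)) (Rbar_locally p_infty).

(* Main.v *)
Require Import Defs.
From Stdlib Require Import Reals Lra.
From Coquelicot Require Import Coquelicot.
(** The change of variable z |-> zeta(z) = Log (2 / (1 + z)) maps the disk into
    the half strip Re > 0, |Im| < pi/2, sends the boundary point -1 to +oo and
    the radius (-1, 0] to the half line [ln 2, +oo).  Choose g so that
    g'(z) dz = W(zeta) d zeta, where
      W(zeta) = exp (- (1 - i zeta / 2) Log (zeta + 1)).
    For large x one has |W(x + i y)| ~ x ^ (- (1 + y / 2)) up to bounded
    factors: this is 1 / (1 + x) exactly on the real axis, where the integral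
    diverges, but at most (1 + x) ^ (- 3 / 2) on the line Im = 1, where it
    converges, and W is bounded on the whole half strip.

    So g has infinite variation along the radius, although every point of the
    disk can be reached from 0 by a path along which g has bounded variation: in
    the zeta-plane go up from ln 2 to ln 2 + i, then right on the line Im = 1,
    then vertically to the endpoint.  Since f g' is analytic, its integral from 0
    to w is the same along this path as along the radius, hence T_g f is bounded
    by a constant times the bound of f (Cmod_segment_integral_le).  The image
    of the disk is {exp x cos y > 1}; the path stays in it when
    Re zeta(w) >= ln 2, because 2 cos 1 > 1.  The other points w satisfy
    |1 + w| > 1, and g' is bounded on the segment from 0 to such a w.

    Independence of the path is used in this form: radial integration produces a
    primitive of any function that is complex differentiable on the disk
    (segment_integral_derive), by Goursat's theorem for triangles (goursat).
    It both defines g and turns path integrals into increments of the primitive,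
    which a mean value inequality bounds (increment_le_along_line).  The
    functions exp and Log are written by their real and imaginary parts, and the
    Cauchy-Riemann equations give their derivatives. *)

Open Scope R_scope.

(** * Continuity and complex differentiability *)

Lemma continuous_Cpair {U : UniformSpace} (f g : U -> R) (x : U) :
  continuous f x -> continuous g x ->
  continuous (fun t => (f t, g t) : C) x.
Proof.
  intros Hf Hg. 
  apply (continuous_comp_2 (X := C_UniformSpace) f g (fun a b => (a, b) : C) x Hf Hg).
  apply (continuous_ext (fun p : C_UniformSpace => p)).
  - intros [a b]; reflexivity.
  - apply continuous_id.
Qed.

Lemma continuous_Re {U : UniformSpace} (f : U -> C) (x : U) :
  continuous f x -> continuous (fun t => Re (f t)) x.
Proof.
  intros Hf. apply (continuous_comp f Re); trivial.
  destruct (f x) as [a b]. apply (@continuous_fst R_UniformSpace R_UniformSpace).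
Qed.

Lemma continuous_Im {U : UniformSpace} (f : U -> C) (x : U) :
  continuous f x -> continuous (fun t => Im (f t)) x.
Proof.
  intros Hf. apply (continuous_comp f Im); trivial.
  destruct (f x) as [a b]. apply (@continuous_snd R_UniformSpace R_UniformSpace).
Qed.

Lemma continuous_Cplus {U : UniformSpace} (f g : U -> C) (x : U) :
  continuous f x -> continuous g x -> continuous (fun t => (f t + g t)%C) x.
Proof.
  intros Hf Hg. apply continuous_Cpair.
  - apply (continuous_plus (V := R_NormedModule) (fun t => Re (f t)) (fun t => Re (g t)));
      now apply continuous_Re.
  - apply (continuous_plus (V := R_NormedModule) (fun t => Im (f t)) (fun t => Im (g t)));
      now apply continuous_Im.
Qed.

Lemma continuous_Cmult {U : UniformSpace} (f g : U -> C) (x : U) :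
  continuous f x -> continuous g x -> continuous (fun t => (f t * g t)%C) x.
Proof.
  intros Hf Hg. apply continuous_Cpair.
  - apply (continuous_minus (V := R_NormedModule)
      (fun t => Re (f t) * Re (g t)) (fun t => Im (f t) * Im (g t)));
    apply (continuous_mult (K := R_AbsRing));
      first [now apply continuous_Re | now apply continuous_Im].
  - apply (continuous_plus (V := R_NormedModule)
      (fun t => Re (f t) * Im (g t)) (fun t => Im (f t) * Re (g t)));
    apply (continuous_mult (K := R_AbsRing));
      first [now apply continuous_Re | now apply continuous_Im].
Qed.

Lemma continuous_RtoC {U : UniformSpace} (f : U -> R) (x : U) :
  continuous f x -> continuous (fun t => RtoC (f t)) x.
Proof.
  intros Hf. apply continuous_Cpair; trivial. apply continuous_const.
Qed.

Lemma continuous_C_eps (q : C -> C) (z : C) :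
  continuous q z <->
  forall eps, 0 < eps ->
  exists delta, 0 < delta /\ forall w, Cmod (w - z) < delta -> Cmod (q w - q z) <= eps.
Proof.
  split.
  - intros Hq eps Heps.
    assert (He2 : 0 < eps / sqrt 2) by (apply Rdiv_lt_0_compat; trivial; apply Rlt_sqrt2_0).
    destruct (Hq (ball (q z) (mkposreal _ He2))) as [d Hd].
    { apply (locally_ball (q z) (mkposreal _ He2)). }
    exists d. split. apply cond_pos. intros w Hw.
    specialize (Hd w). 
    assert (Hb : ball z d w) by (apply C_NormedModule_mixin_compat1, Hw).
    specialize (Hd Hb).
    apply C_NormedModule_mixin_compat2 in Hd. simpl in Hd.
    left. replace eps with (sqrt 2 * (eps / sqrt 2)). exact Hd.
    field. apply Rgt_not_eq, Rlt_sqrt2_0.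
  - intros Hq P [e He].
    destruct (Hq (e / 2)) as [d [Hd Hq']]. { apply is_pos_div_2. }
    assert (Hd2 : 0 < d / sqrt 2) by (apply Rdiv_lt_0_compat; trivial; apply Rlt_sqrt2_0).
    exists (mkposreal _ Hd2). intros w Hw. apply He.
    apply C_NormedModule_mixin_compat1.
    apply C_NormedModule_mixin_compat2 in Hw. simpl in Hw.
    apply Rle_lt_trans with (e / 2).
    + apply Hq'. replace d with (sqrt 2 * (d / sqrt 2)). exact Hw.
      field. apply Rgt_not_eq, Rlt_sqrt2_0.
    + pose proof (cond_pos e). lra.
Qed.

Local Notation is_Cderive := (@is_derive C_AbsRing C_NormedModule).

Lemma is_Cderive_eps (f : C -> C) (z l : C) :
  is_Cderive f z l <->
  forall eps, 0 < eps -> exists delta, 0 < delta /\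
    forall w, Cmod (w - z) < delta ->
      Cmod (f w - f z - l * (w - z)) <= eps * Cmod (w - z).
Proof.
  split.
  - intros [_ Hd] eps Heps.
    destruct (Hd z (fun P H => H) (mkposreal _ Heps)) as [d H].
    exists d. split. apply cond_pos. intros w Hw.
    specialize (H w Hw). rewrite (Cmult_comm l). exact H.
  - intros H. split. apply is_linear_scal_l.
    intros x Hx. 
    assert (E : z = x).
    { apply (is_filter_lim_locally_unique (K := C_AbsRing) (V := AbsRing_NormedModule C_AbsRing) z x).
      exact Hx. }
    subst x. intros eps. destruct (H eps (cond_pos eps)) as [d [Hd H']].
    exists (mkposreal _ Hd). intros w Hw. specialize (H' w Hw).
    rewrite (Cmult_comm l) in H'. exact H'.
Qed.

(** Caratheodory's form of differentiability: the difference quotient extends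
    continuously.  It makes the product and chain rules algebraic identities
    between slopes, and avoids moving between the two uniform structures that C
    carries (balls for the modulus, products of real balls). *)
Lemma is_Cderive_slope (f : C -> C) (z l : C) :
  is_Cderive f z l <->
  exists q : C -> C, @continuous C_UniformSpace C_UniformSpace q z /\ q z = l /\
    forall w, f w = (f z + q w * (w - z))%C.
Proof.
  rewrite is_Cderive_eps. split.
  - intros H.
    pose (q := fun w => match Req_EM_T (Cmod (w - z)) 0 with
      | left _ => l | right _ => ((f w - f z) / (w - z))%C end).
    assert (Ez : q z = l).
    { unfold q. destruct (Req_EM_T _ _) as [_ | n]; trivial.
      exfalso. apply n. replace (z - z)%C with (RtoC 0) by ring. apply Cmod_0. }
    exists q. split; [ | split]; trivial.
    + apply continuous_C_eps. intros eps Heps.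
      destruct (H eps Heps) as [d [Hd H']]. exists d. split; trivial.
      intros w Hw. rewrite Ez. unfold q. destruct (Req_EM_T _ _) as [e | n].
      * replace (l - l)%C with (RtoC 0) by ring. rewrite Cmod_0. lra.
      * assert (n' : (w - z)%C <> 0). { intros e. apply n. rewrite e. apply Cmod_0. }
        replace ((f w - f z) / (w - z) - l)%C with ((f w - f z - l * (w - z)) / (w - z))%C
          by now field.
        rewrite Cmod_div by trivial.
        apply Rmult_le_reg_r with (Cmod (w - z)). now apply Cmod_gt_0.
        unfold Rdiv. rewrite Rmult_assoc, Rinv_l, Rmult_1_r by trivial. now apply H'.
    + intros w. unfold q. destruct (Req_EM_T _ _) as [e | n].
      * apply Cmod_eq_0 in e. rewrite e.
        replace w with z. ring. replace w with (z + (w - z))%C by ring. rewrite e. ring.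
      * field. intros e. apply n. rewrite e. apply Cmod_0.
  - intros [q [Hq [Ez Hf]]] eps Heps.
    destruct (proj1 (continuous_C_eps q z) Hq eps Heps) as [d [Hd H]].
    exists d. split; trivial. intros w Hw.
    rewrite (Hf w), <- Ez.
    replace (f z + q w * (w - z) - f z - q z * (w - z))%C with ((q w - q z) * (w - z))%C by ring.
    rewrite Cmod_mult. apply Rmult_le_compat_r. apply Cmod_ge_0. now apply H.
Qed.

Lemma is_Cderive_continuous (f : C -> C) (z l : C) :
  is_Cderive f z l -> @continuous C_UniformSpace C_UniformSpace f z.
Proof.
  intros H. apply is_Cderive_slope in H. destruct H as [q [Hq [_ Hf]]].
  apply (continuous_ext (fun w => f z + q w * (w + - z))%C).
  - intros w. now rewrite (Hf w).
  - apply continuous_Cplus; [apply continuous_const | apply continuous_Cmult; trivial].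
    apply continuous_Cplus; [apply continuous_id | apply continuous_const].
Qed.

Lemma is_Cderive_mult (f g : C -> C) (z l m : C) :
  is_Cderive f z l -> is_Cderive g z m ->
  is_Cderive (fun w => f w * g w)%C z (l * g z + f z * m)%C.
Proof.
  intros Hf Hg. pose proof (is_Cderive_continuous _ _ _ Hg) as Cg.
  apply is_Cderive_slope in Hf. apply is_Cderive_slope in Hg.
  destruct Hf as [p [Hp [Ep Hf]]]. destruct Hg as [q [Hq [Eq Hg]]].
  apply is_Cderive_slope. exists (fun w => p w * g w + f z * q w)%C.
  split; [ | split].
  - apply continuous_Cplus; apply continuous_Cmult; trivial. apply continuous_const.
  - now rewrite Ep, Eq.
  - intros w.
    assert (E1 : (f w - f z = p w * (w - z))%C) by (rewrite (Hf w); ring).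
    assert (E2 : (g w - g z = q w * (w - z))%C) by (rewrite (Hg w); ring).
    cbv beta. transitivity (f z * g z + (p w * (w - z)) * g w + f z * (q w * (w - z)))%C; [|ring].
    rewrite <- E1, <- E2. ring.
Qed.

Lemma is_Cderive_comp (f g : C -> C) (z l m : C) :
  is_Cderive f (g z) l -> is_Cderive g z m ->
  is_Cderive (fun w => f (g w)) z (l * m)%C.
Proof.
  intros Hf Hg. pose proof (is_Cderive_continuous _ _ _ Hg) as Cg.
  apply is_Cderive_slope in Hf. apply is_Cderive_slope in Hg.
  destruct Hf as [p [Hp [Ep Hf]]]. destruct Hg as [q [Hq [Eq Hg]]].
  apply is_Cderive_slope. exists (fun w => p (g w) * q w)%C.
  split; [ | split].
  - apply continuous_Cmult; trivial. now apply (continuous_comp g p).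
  - now rewrite Ep, Eq.
  - intros w. rewrite (Hf (g w)).
    assert (E2 : (g w - g z = q w * (w - z))%C) by (rewrite (Hg w); ring).
    rewrite E2. ring.
Qed.

Lemma is_Cderive_affine (c d z : C) : is_Cderive (fun w => c + d * w)%C z d.
Proof.
  apply is_Cderive_slope. exists (fun _ => d). split; [ | split]; trivial.
  - apply continuous_const.
  - intros w. ring.
Qed.

Lemma is_Cderive_plus (f g : C -> C) (z l m : C) :
  is_Cderive f z l -> is_Cderive g z m ->
  is_Cderive (fun w => f w + g w)%C z (l + m)%C.
Proof. apply (is_derive_plus (K := C_AbsRing) (V := C_NormedModule)). Qed.

(** [ring] does not see C behind the carriers of the module structures on C. *)
Ltac Cring := match goal with |- @eq _ ?x ?y => change (@eq C x y) end; ring.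

(** * Integrals along segments *)

Lemma Cmod_norm_R (z : C) : @norm R_AbsRing C_R_NormedModule z = Cmod z.
Proof.
  unfold norm; simpl. unfold prod_norm, Cmod; simpl.
  unfold norm; simpl. unfold abs; simpl. f_equal.
  rewrite !Rmult_1_r, <- !Rabs_mult, !Rabs_pos_eq; trivial; apply Rle_0_sqr.
Qed.

Lemma scal_R_Cmult (k : R) (z : C) : @scal R_AbsRing C_R_NormedModule k z = (RtoC k * z)%C.
Proof.
  destruct z as [x y]. unfold scal; simpl. unfold prod_scal, Cmult; simpl.
  unfold scal; simpl. unfold mult; simpl. f_equal; ring.
Qed.

(** The bridge from complex to real calculus: it gives both the fundamental
    theorem for segment integrals and the mean value inequality below. *)
Lemma is_derive_along_line (G : C -> C) (a b l : C) (t : R) :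
  is_Cderive G (a + t * b)%C l ->
  @is_derive R_AbsRing C_R_NormedModule (fun s : R => G (a + s * b)%C) t (l * b)%C.
Proof.
  intros H. rewrite is_Cderive_eps in H.
  split. apply is_linear_scal_l.
  intros x Hx.
  assert (E : t = x).
  { apply (is_filter_lim_locally_unique (K := R_AbsRing) (V := R_NormedModule) t x). exact Hx. }
  subst x. intros eps.
  assert (Hb : 0 < Cmod b + 1) by (pose proof (Cmod_ge_0 b); lra).
  destruct (H (eps / (Cmod b + 1))) as [d [Hd H']].
  { apply Rdiv_lt_0_compat; trivial. apply cond_pos. }
  assert (Hd' : 0 < d / (Cmod b + 1)) by now apply Rdiv_lt_0_compat.
  exists (mkposreal _ Hd'). intros s Hs.
  assert (Hs' : Rabs (s - t) < d / (Cmod b + 1)) by exact Hs. clear Hs.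
  assert (Es : ((a + s * b) - (a + t * b))%C = ((s - t)%R * b)%C).
  { rewrite RtoC_minus. ring. }
  rewrite Cmod_norm_R.
  specialize (H' (a + s * b)%C). rewrite Es, Cmod_mult, Cmod_R in H'.
  rewrite scal_R_Cmult.
  match goal with |- Cmod ?u <= _ => replace u with (G (a + s * b) - G (a + t * b) - l * ((s - t)%R * b))%C end.
  2:{ change (minus s t) with (s - t)%R.
      replace (l * ((s - t)%R * b))%C with ((s - t)%R * (l * b))%C by ring. reflexivity. }
  assert (Hle : Rabs (s - t) * Cmod b <= Rabs (s - t) * (Cmod b + 1)).
  { apply Rmult_le_compat_l. apply Rabs_pos. lra. }
  eapply Rle_trans. apply H'.
  - apply Rle_lt_trans with (1 := Hle).
    apply Rmult_lt_reg_r with (/ (Cmod b + 1)). now apply Rinv_0_lt_compat.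
    rewrite Rmult_assoc, Rinv_r, Rmult_1_r by lra. exact Hs'.
  - change (norm (minus s t)) with (Rabs (s - t)).
    apply Rle_trans with (eps / (Cmod b + 1) * (Rabs (s - t) * (Cmod b + 1))).
    + apply Rmult_le_compat_l; trivial. apply Rlt_le, Rdiv_lt_0_compat; trivial. apply cond_pos.
    + right. field. lra.
Qed.

Definition is_seg_int (h : C -> C) (a b I : C) : Prop :=
  @is_RInt C_R_NormedModule (fun s : R => (h (a + s * (b - a)) * (b - a))%C) 0 1 I.

Definition seg_int (h : C -> C) (a b : C) : C :=
  @RInt C_R_CompleteNormedModule (fun s : R => (h (a + s * (b - a)) * (b - a))%C) 0 1.

Lemma segment_integral_seg_int (h : C -> C) (z : C) : segment_integral h z = seg_int h 0 z.
Proof.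
  unfold segment_integral, seg_int. apply (RInt_ext (V := C_R_CompleteNormedModule)). intros s _.
  replace (z - 0)%C with z by ring. now replace (0 + s * z)%C with (s * z)%C by ring.
Qed.

Lemma is_seg_int_unique h a b I : is_seg_int h a b I -> seg_int h a b = I.
Proof. apply (is_RInt_unique (V := C_R_CompleteNormedModule)). Qed.

Lemma Cmod_convex (p a b : C) (r s : R) :
  0 <= s <= 1 -> Cmod (a - p) <= r -> Cmod (b - p) <= r -> Cmod (a + s * (b - a) - p) <= r.
Proof.
  intros Hs Ha Hb.
  replace (a + s * (b - a) - p)%C with ((1 - s)%R * (a - p) + s * (b - p))%C.
  2:{ rewrite RtoC_minus. ring. }
  eapply Rle_trans. apply Cmod_triangle.
  rewrite !Cmod_mult, !Cmod_R, !Rabs_pos_eq by lra.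
  apply Rle_trans with ((1 - s) * r + s * r); [ | lra].
  apply Rplus_le_compat; apply Rmult_le_compat_l; lra.
Qed.

Lemma unit_disk_convex (a b : C) (s : R) :
  0 <= s <= 1 -> unit_disk a -> unit_disk b -> unit_disk (a + s * (b - a)).
Proof.
  unfold unit_disk. intros Hs Ha Hb.
  assert (H : Cmod (a + s * (b - a) - 0) <= Rmax (Cmod a) (Cmod b)).
  { apply Cmod_convex; trivial.
    - replace (a - 0)%C with a by ring. apply Rmax_l.
    - replace (b - 0)%C with b by ring. apply Rmax_r. }
  replace (a + s * (b - a) - 0)%C with (a + s * (b - a))%C in H by ring.
  apply Rle_lt_trans with (1 := H). now apply Rmax_lub_lt.
Qed.

Definition continuous_on_disk (h : C -> C) : Prop :=
  forall z, unit_disk z -> @continuous C_UniformSpace C_UniformSpace h z.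

Lemma analytic_continuous (h : C -> C) : analytic_on_disk h -> continuous_on_disk h.
Proof.
  intros Hh z Hz. destruct (Hh z Hz) as [l Hl]. now apply (is_Cderive_continuous h z l).
Qed.

Lemma continuous_line (a b : C) (s : R) :
  continuous (fun s : R => (a + s * b)%C) s.
Proof.
  apply continuous_Cplus; [apply continuous_const | apply continuous_Cmult].
  - apply continuous_RtoC, continuous_id.
  - apply continuous_const.
Qed.

Lemma continuous_seg_int_integrand h a b s :
  continuous_on_disk h -> unit_disk a -> unit_disk b -> 0 <= s <= 1 ->
  continuous (fun s : R => (h (a + s * (b - a)) * (b - a))%C) s.
Proof.
  intros Hh Ha Hb Hs. apply continuous_Cmult; [ | apply continuous_const].
  apply (continuous_comp (fun s : R => a + s * (b - a))%C h).
  - apply continuous_line.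
  - now apply Hh, unit_disk_convex.
Qed.

Lemma ex_RInt_seg_int_integrand h a b u v :
  continuous_on_disk h -> unit_disk a -> unit_disk b -> 0 <= u <= 1 -> 0 <= v <= 1 ->
  exists I, @is_RInt C_R_NormedModule (fun s : R => (h (a + s * (b - a)) * (b - a))%C) u v I.
Proof.
  intros Hh Ha Hb Hu Hv.
  apply (ex_RInt_continuous (V := C_R_CompleteNormedModule)).
  intros z Hz. apply continuous_seg_int_integrand; trivial.
  revert Hz. unfold Rmin, Rmax. destruct (Rle_dec u v); lra.
Qed.

Lemma seg_int_correct h a b :
  continuous_on_disk h -> unit_disk a -> unit_disk b -> is_seg_int h a b (seg_int h a b).
Proof.
  intros Hh Ha Hb. apply (RInt_correct (V := C_R_CompleteNormedModule)).
  apply ex_RInt_seg_int_integrand; trivial; lra.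
Qed.

(** One affine change of variable covers reversal (u = 1, v = 0) and bisection
    (u, v at 0, 1/2, 1). *)
Lemma is_seg_int_subsegment h a b u v I :
  @is_RInt C_R_NormedModule (fun s : R => (h (a + s * (b - a)) * (b - a))%C) u v I ->
  is_seg_int h (a + u * (b - a)) (a + v * (b - a)) I.
Proof.
  intros H. unfold is_seg_int.
  apply (is_RInt_ext (V := C_R_NormedModule) (fun y : R => scal (v - u)
    (h (a + ((v - u) * y + u)%R * (b - a)) * (b - a))%C)).
  - intros s _. rewrite scal_R_Cmult.
    rewrite RtoC_plus, RtoC_mult, RtoC_minus.
    replace (a + u * (b - a) + s * (a + v * (b - a) - (a + u * (b - a))))%C
      with (a + ((v - u) * s + u) * (b - a))%C by ring. Cring.
  - apply (is_RInt_comp_lin (V := C_R_NormedModule)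
      (fun s : R => (h (a + s * (b - a)) * (b - a))%C)).
    replace ((v - u) * 0 + u) with u by ring.
    replace ((v - u) * 1 + u) with v by ring. exact H.
Qed.

Lemma seg_int_swap h a b :
  continuous_on_disk h -> unit_disk a -> unit_disk b -> seg_int h b a = (- seg_int h a b)%C.
Proof.
  intros Hh Ha Hb. apply is_seg_int_unique.
  pose proof (is_seg_int_subsegment h a b 1 0 (- seg_int h a b)%C) as H.
  replace (a + 1 * (b - a))%C with b in H by ring.
  replace (a + 0 * (b - a))%C with a in H by ring.
  apply H. apply (is_RInt_swap (V := C_R_NormedModule)).
  now apply seg_int_correct.
Qed.

Definition midpoint (a b : C) : C := ((a + b) / 2)%C.

Lemma C2_neq_0 : RtoC 2 <> 0.
Proof. intros H. apply RtoC_inj in H. lra. Qed.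

Lemma midpoint_param (a b : C) : midpoint a b = (a + (/ 2)%R * (b - a))%C.
Proof. unfold midpoint. rewrite RtoC_inv. field. lra. Qed.

Lemma seg_int_midpoint h a b :
  continuous_on_disk h -> unit_disk a -> unit_disk b ->
  seg_int h a b = (seg_int h a (midpoint a b) + seg_int h (midpoint a b) b)%C.
Proof.
  intros Hh Ha Hb. apply is_seg_int_unique.
  destruct (ex_RInt_seg_int_integrand h a b 0 (/ 2)) as [I HI]; trivial; try lra.
  destruct (ex_RInt_seg_int_integrand h a b (/ 2) 1) as [J HJ]; trivial; try lra.
  pose proof (is_seg_int_unique _ _ _ _ (is_seg_int_subsegment _ _ _ _ _ _ HI)) as EI.
  pose proof (is_seg_int_unique _ _ _ _ (is_seg_int_subsegment _ _ _ _ _ _ HJ)) as EJ.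
  rewrite <- midpoint_param in EI, EJ.
  replace (a + 0 * (b - a))%C with a in EI by ring.
  replace (a + 1 * (b - a))%C with b in EJ by ring.
  rewrite EI, EJ.
  exact (is_RInt_Chasles (V := C_R_NormedModule) _ _ _ _ _ _ HI HJ).
Qed.

Lemma seg_int_minus h k a b :
  continuous_on_disk h -> continuous_on_disk k -> unit_disk a -> unit_disk b ->
  seg_int (fun z => h z - k z)%C a b = (seg_int h a b - seg_int k a b)%C.
Proof.
  intros Hh Hk Ha Hb. apply is_seg_int_unique.
  apply (is_RInt_ext (V := C_R_NormedModule) (fun s : R =>
    @minus C_R_NormedModule (h (a + s * (b - a)) * (b - a))%C (k (a + s * (b - a)) * (b - a))%C)).
  - intros s _. unfold minus, plus, opp; simpl.
    change (h (a + s * (b - a)) * (b - a) - k (a + s * (b - a)) * (b - a) =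
      (h (a + s * (b - a)) - k (a + s * (b - a))) * (b - a))%C. ring.
  - apply (is_RInt_minus (V := C_R_NormedModule)); now apply seg_int_correct.
Qed.

Lemma Cmod_seg_int_le h a b M :
  continuous_on_disk h -> unit_disk a -> unit_disk b ->
  (forall s, 0 <= s <= 1 -> Cmod (h (a + s * (b - a))%C) <= M) ->
  Cmod (seg_int h a b) <= M * Cmod (b - a).
Proof.
  intros Hh Ha Hb HM. rewrite <- Cmod_norm_R.
  apply (norm_RInt_le (V := C_R_NormedModule)
    (fun s : R => (h (a + s * (b - a)) * (b - a))%C) (fun _ => M * Cmod (b - a)) 0 1).
  - lra.
  - intros s Hs. rewrite Cmod_norm_R, Cmod_mult.
    apply Rmult_le_compat_r. apply Cmod_ge_0. now apply HM.
  - now apply seg_int_correct.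
  - pose proof (is_RInt_const (V := R_NormedModule) 0 1 (M * Cmod (b - a))) as H.
    unfold scal in H; simpl in H. unfold mult in H; simpl in H.
    replace ((1 - 0) * (M * Cmod (b - a))) with (M * Cmod (b - a)) in H by ring. exact H.
Qed.

Lemma seg_int_primitive G h a b :
  continuous_on_disk h -> (forall z, unit_disk z -> is_Cderive G z (h z)) ->
  unit_disk a -> unit_disk b -> seg_int h a b = (G b - G a)%C.
Proof.
  intros Hh HG Ha Hb. apply is_seg_int_unique.
  replace (G b - G a)%C with (minus (G (a + 1 * (b - a))%C) (G (a + 0 * (b - a))%C) : C_R_NormedModule).
  2:{ replace (a + 1 * (b - a))%C with b by ring. 
      replace (a + 0 * (b - a))%C with a by ring. reflexivity. }
  apply (is_RInt_derive (V := C_R_CompleteNormedModule) (fun s : R => G (a + s * (b - a))%C)).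
  - intros s. rewrite Rmin_left, Rmax_right by lra. intros Hs.
    apply is_derive_along_line. now apply HG, unit_disk_convex.
  - intros s. rewrite Rmin_left, Rmax_right by lra. intros Hs.
    now apply continuous_seg_int_integrand.
Qed.

(** * Goursat's theorem and primitives on the disk *)

(** The tails of the sum of s / 2^k are 2 s / 2^n, so x_n - 2 s / 2^n increases,
    x_n + 2 s / 2^n decreases, and both converge to the same limit. *)
Lemma geometric_Cauchy (x : nat -> R) (s : R) :
  (forall n, Rabs (x (S n) - x n) <= s * (/ 2) ^ n) ->
  exists l, forall n, Rabs (x n - l) <= 2 * s * (/ 2) ^ n.
Proof.
  intros Hx.
  assert (Hp : forall n, 0 < (/ 2) ^ n) by (intros n; apply pow_lt; lra).
  set (c := fun n => 2 * s * (/ 2) ^ n).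
  assert (Hc : forall n, c (S n) = c n - s * (/ 2) ^ n).
  { intros n. unfold c. simpl. lra. }
  assert (Hincr : forall n, x n - c n <= x (S n) - c (S n)).
  { intros n. rewrite Hc. pose proof (proj1 (Rabs_le_between _ _) (Hx n)). lra. }
  assert (Hdecr : forall n, x (S n) + c (S n) <= x n + c n).
  { intros n. rewrite Hc. pose proof (proj1 (Rabs_le_between _ _) (Hx n)). lra. }
  assert (Hlim : is_lim_seq (fun n => (x n + c n) - (x n - c n)) 0).
  { apply (is_lim_seq_ext (fun n => (4 * s) * (/ 2) ^ n)).
    - intros n. unfold c. ring.
    - replace (Finite 0) with (Rbar_mult (4 * s) 0) by (simpl; f_equal; ring).
      apply is_lim_seq_scal_l, is_lim_seq_geom. rewrite Rabs_pos_eq; lra. }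
  destruct (ex_lim_seq_adj (fun n => x n - c n) (fun n => x n + c n))
    as [[l Hu] [[m Hv] E]]; trivial.
  rewrite (is_lim_seq_unique _ _ Hu), (is_lim_seq_unique _ _ Hv) in E.
  injection E as <-. exists l. intros n. fold (c n).
  pose proof (is_lim_seq_incr_compare _ _ Hu Hincr n).
  pose proof (is_lim_seq_decr_compare _ _ Hv Hdecr n).
  simpl in *.
  apply Rabs_le_between. lra.
Qed.

Lemma Cmod_le_Re_Im (z : C) : Cmod z <= Rabs (Re z) + Rabs (Im z).
Proof.
  destruct z as [x y]. simpl.
  replace (x, y) with (RtoC x + Ci * RtoC y)%C.
  2:{ unfold Cplus, Cmult, Ci, RtoC; simpl. f_equal; ring. }
  eapply Rle_trans. apply Cmod_triangle.
  rewrite Cmod_mult, Cmod_Ci, !Cmod_R. lra.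
Qed.

Lemma geometric_Cauchy_C (z : nat -> C) (s : R) :
  (forall n, Cmod (z (S n) - z n) <= s * (/ 2) ^ n) ->
  exists p, forall n, Cmod (z n - p) <= 4 * s * (/ 2) ^ n.
Proof.
  intros Hz.
  destruct (geometric_Cauchy (fun n => Re (z n)) s) as [x Hx].
  { intros n. eapply Rle_trans; [ | apply Hz]. eapply Rle_trans; [ | apply re_le_Cmod]. right; reflexivity. }
  destruct (geometric_Cauchy (fun n => Im (z n)) s) as [y Hy].
  { intros n. eapply Rle_trans; [ | apply Hz].
    eapply Rle_trans; [ | apply Rmax_Cmod]. eapply Rle_trans; [ | apply Rmax_r]. right; reflexivity. }
  exists (x, y). intros n. eapply Rle_trans. apply Cmod_le_Re_Im.
  replace (4 * s * (/ 2) ^ n) with (2 * s * (/ 2) ^ n + 2 * s * (/ 2) ^ n) by ring.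
  apply Rplus_le_compat; [apply (Hx n) | apply (Hy n)].
Qed.

Lemma le_geometric (a b k : R) : (forall n, a <= b + k * (/ 2) ^ n) -> a <= b.
Proof.
  intros H.
  assert (L : is_lim_seq (fun n => b + k * (/ 2) ^ n) b).
  { replace (Finite b) with (Rbar_plus b (Rbar_mult k 0)) by (simpl; f_equal; ring).
    apply is_lim_seq_plus'; [apply is_lim_seq_const | ].
    apply (is_lim_seq_scal_l _ k 0), is_lim_seq_geom. rewrite Rabs_pos_eq; lra. }
  exact (is_lim_seq_le (fun _ => a) _ a b H (is_lim_seq_const a) L).
Qed.

Definition triangle : Type := (C * C * C)%type.

Definition tri_int (h : C -> C) (T : triangle) : C :=
  let '(a, b, c) := T in (seg_int h a b + seg_int h b c + seg_int h c a)%C.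

(** The radius r keeps all the triangles of a nested sequence in one compact
    disk, so that their limit point stays in the open unit disk. *)
Definition tri_bound (r s : R) (T : triangle) : Prop :=
  let '(a, b, c) := T in
  (Cmod a <= r /\ Cmod b <= r /\ Cmod c <= r) /\
  (Cmod (b - a) <= s /\ Cmod (c - b) <= s /\ Cmod (a - c) <= s).

Definition first_vertex (T : triangle) : C := fst (fst T).

Definition corner_a (T : triangle) : triangle :=
  let '(a, b, c) := T in (a, midpoint a b, midpoint c a).
Definition corner_b (T : triangle) : triangle :=
  let '(a, b, c) := T in (midpoint a b, b, midpoint b c).
Definition corner_c (T : triangle) : triangle :=
  let '(a, b, c) := T in (midpoint c a, midpoint b c, c).
Definition medial (T : triangle) : triangle :=
  let '(a, b, c) := T in (midpoint a b, midpoint b c, midpoint c a).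

Lemma Cmod_midpoint (a b : C) (r : R) :
  Cmod a <= r -> Cmod b <= r -> Cmod (midpoint a b) <= r.
Proof.
  intros Ha Hb. rewrite midpoint_param.
  replace (a + (/ 2)%R * (b - a))%C with (a + (/ 2)%R * (b - a) - 0)%C by ring.
  apply Cmod_convex; [lra | | ].
  - now replace (a - 0)%C with a by ring.
  - now replace (b - 0)%C with b by ring.
Qed.

Lemma Cmod_half_le (x z : C) (s : R) :
  Cmod z <= s -> x = (z / 2)%C \/ x = (- (z / 2))%C -> Cmod x <= s / 2.
Proof.
  intros Hz [-> | ->]; rewrite ?Cmod_opp, Cmod_div, Cmod_R, Rabs_pos_eq;
    try apply C2_neq_0; lra.
Qed.

Lemma tri_bound_sub (r s : R) (T : triangle) : tri_bound r s T ->
  tri_bound r (s / 2) (corner_a T) /\ tri_bound r (s / 2) (corner_b T) /\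
  tri_bound r (s / 2) (corner_c T) /\ tri_bound r (s / 2) (medial T).
Proof.
  destruct T as [[a b] c]. intros [[Ha [Hb Hc]] [Hab [Hbc Hca]]].
  pose proof (Cmod_midpoint a b r Ha Hb). pose proof (Cmod_midpoint b c r Hb Hc).
  pose proof (Cmod_midpoint c a r Hc Ha).
  repeat split; trivial;
  first
  [ apply (Cmod_half_le _ _ _ Hab); unfold midpoint;
    first [left; field | right; field]
  | apply (Cmod_half_le _ _ _ Hbc); unfold midpoint;
    first [left; field | right; field]
  | apply (Cmod_half_le _ _ _ Hca); unfold midpoint;
    first [left; field | right; field] ].
Qed.

(** The sides of the medial triangle are each run through twice, in opposite
    directions, and cancel. *)
Lemma tri_int_sub (h : C -> C) (r s : R) (T : triangle) :
  continuous_on_disk h -> r < 1 -> tri_bound r s T ->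
  tri_int h T = (tri_int h (corner_a T) + tri_int h (corner_b T)
                 + tri_int h (corner_c T) + tri_int h (medial T))%C.
Proof.
  destruct T as [[a b] c]. intros Hh Hr [[Ha [Hb Hc]] _].
  pose proof (Cmod_midpoint a b r Ha Hb) as Hp. pose proof (Cmod_midpoint b c r Hb Hc) as Hq.
  pose proof (Cmod_midpoint c a r Hc Ha) as Hm.
  assert (D : forall z, Cmod z <= r -> unit_disk z) by (unfold unit_disk; intros; lra).
  unfold tri_int, corner_a, corner_b, corner_c, medial.
  rewrite (seg_int_midpoint h a b), (seg_int_midpoint h b c), (seg_int_midpoint h c a) by auto.
  rewrite (seg_int_swap h (midpoint a b) (midpoint b c)) by auto.
  rewrite (seg_int_swap h (midpoint b c) (midpoint c a)) by auto.
  rewrite (seg_int_swap h (midpoint c a) (midpoint a b)) by auto.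
  ring.
Qed.

(** A piece that carries at least a quarter of the integral over [T]: if none of
    the three corners does, the medial triangle must. *)
Definition tri_pick (h : C -> C) (T : triangle) : triangle :=
  let large T' := Rle_dec (Cmod (tri_int h T)) (4 * Cmod (tri_int h T')) in
  if large (corner_a T) then corner_a T else
  if large (corner_b T) then corner_b T else
  if large (corner_c T) then corner_c T else medial T.

Lemma tri_pick_large (h : C -> C) (r s : R) (T : triangle) :
  continuous_on_disk h -> r < 1 -> tri_bound r s T ->
  Cmod (tri_int h T) <= 4 * Cmod (tri_int h (tri_pick h T)).
Proof.
  intros Hh Hr HT. unfold tri_pick.
  destruct (Rle_dec _ _) as [H | HA]; trivial.
  destruct (Rle_dec _ _) as [H | HB]; trivial.
  destruct (Rle_dec _ _) as [H | HC]; trivial.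
  assert (Hsum : Cmod (tri_int h T) <= Cmod (tri_int h (corner_a T)) + Cmod (tri_int h (corner_b T))
    + Cmod (tri_int h (corner_c T)) + Cmod (tri_int h (medial T))).
  { rewrite (tri_int_sub h r s T) at 1 by trivial.
    eapply Rle_trans; [apply Cmod_triangle | apply Rplus_le_compat_r].
    eapply Rle_trans; [apply Cmod_triangle | apply Rplus_le_compat_r].
    apply Cmod_triangle. }
  lra.
Qed.

Lemma tri_pick_bound (h : C -> C) (r s : R) (T : triangle) :
  tri_bound r s T -> tri_bound r (s / 2) (tri_pick h T).
Proof.
  intros HT. destruct (tri_bound_sub r s T HT) as [HA [HB [HC HM]]].
  unfold tri_pick. now repeat destruct (Rle_dec _ _).
Qed.

Lemma tri_pick_vertex (h : C -> C) (r s : R) (T : triangle) :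
  tri_bound r s T -> Cmod (first_vertex (tri_pick h T) - first_vertex T) <= s.
Proof.
  destruct T as [[a b] c]. intros [_ [Hab [_ Hca]]].
  assert (Hs : 0 <= s) by (pose proof (Cmod_ge_0 (b - a)); lra).
  assert (Hp : Cmod (midpoint a b - a) <= s / 2).
  { apply (Cmod_half_le _ _ _ Hab). left. unfold midpoint. field. }
  assert (Hq : Cmod (midpoint c a - a) <= s / 2).
  { apply (Cmod_half_le _ _ _ Hca). right. unfold midpoint. field. }
  unfold tri_pick. repeat destruct (Rle_dec _ _); unfold first_vertex; simpl; try lra.
  replace (a - a)%C with (RtoC 0) by ring. rewrite Cmod_0. lra.
Qed.

(** Near p, the function h differs from an affine function by at most
    eps |w - p|.  Affine functions have primitives, so only this difference
    contributes to the integral.  Every point of [T] is within 4 s + s of p, and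
    the perimeter is at most 3 s, whence the constant 15. *)
Lemma tri_int_differentiable (h : C -> C) (p l : C) (eps delta r s : R) (T : triangle) :
  continuous_on_disk h -> r < 1 -> tri_bound r s T -> 
  (forall w, Cmod (w - p) < delta -> Cmod (h w - h p - l * (w - p)) <= eps * Cmod (w - p)) ->
  0 <= eps -> Cmod (first_vertex T - p) <= 4 * s -> 5 * s < delta ->
  Cmod (tri_int h T) <= 15 * eps * s ^ 2.
Proof.
  intros Hh Hr HT Hw He Hv Hs.
  set (aff := fun w => (h p - l * p + l * w)%C).
  set (prim := fun w => ((h p - l * p) * w + l / 2 * (w * w))%C).
  assert (Haff : continuous_on_disk aff).
  { intros z _. apply (is_Cderive_continuous _ _ l). apply is_Cderive_affine. }
  assert (Hprim : forall z, unit_disk z -> is_Cderive prim z (aff z)).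
  { intros z _. unfold prim, aff.
    replace (h p - l * p + l * z)%C
      with ((h p - l * p) + (0 * (z * z) + l / 2 * (1 * z + z * 1)))%C.
    2:{ field. }
    apply is_Cderive_plus.
    - pose proof (is_Cderive_affine (RtoC 0) (h p - l * p)%C z) as H.
      revert H. apply is_derive_ext. intros t. Cring.
    - assert (Hid : is_Cderive (fun w => w) z (RtoC 1)).
      { pose proof (is_Cderive_affine (RtoC 0) (RtoC 1) z) as H.
        revert H. apply is_derive_ext. intros t. Cring. }
      apply (is_Cderive_mult (fun _ => l / 2)%C (fun w => w * w)%C).
      + apply (is_derive_const (K := C_AbsRing) (V := C_NormedModule)).
      + now apply (is_Cderive_mult (fun w => w) (fun w => w)). }
  assert (D : forall z, Cmod z <= r -> unit_disk z) by (unfold unit_disk; intros; lra).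
  destruct T as [[a b] c]. unfold first_vertex in Hv; simpl in Hv.
  destruct HT as [[Ha [Hb Hc]] [Hab [Hbc Hca]]].
  assert (Hs0 : 0 <= s) by (pose proof (Cmod_ge_0 (b - a)); lra).
  set (k := fun w => (h w - aff w)%C).
  assert (Hk : continuous_on_disk k).
  { intros z Hz. apply continuous_Cplus. now apply Hh.
    apply (continuous_ext (fun w => (- (1)) * aff w)%C).
    - intros w. Cring.
    - apply continuous_Cmult. apply continuous_const. now apply Haff. }
  assert (E : tri_int h (a, b, c) = tri_int k (a, b, c)).
  { unfold tri_int, k. 
    rewrite !seg_int_minus by auto.
    rewrite !(seg_int_primitive prim aff) by auto. ring. }
  assert (Hside : forall u v, Cmod u <= r -> Cmod v <= r -> Cmod (u - p) <= 5 * s ->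
    Cmod (v - p) <= 5 * s -> Cmod (v - u) <= s -> Cmod (seg_int k u v) <= 5 * eps * s * s).
  { intros u v Hu Hv' Hup Hvp Huv.
    eapply Rle_trans. apply (Cmod_seg_int_le k u v (eps * (5 * s))); auto.
    - intros t Ht. pose proof (Cmod_convex p u v _ _ Ht Hup Hvp) as Hcv.
      unfold k, aff.
      replace (h (u + t * (v - u)) - (h p - l * p + l * (u + t * (v - u))))%C
        with (h (u + t * (v - u)) - h p - l * (u + t * (v - u) - p))%C by ring.
      eapply Rle_trans. apply Hw. lra. now apply Rmult_le_compat_l.
    - replace (5 * eps * s * s) with (eps * (5 * s) * s) by ring.
      apply Rmult_le_compat_l; trivial. apply Rmult_le_pos; lra. }
  assert (Hbp : Cmod (b - p) <= 5 * s).
  { replace (b - p)%C with ((b - a) + (a - p))%C by ring.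
    pose proof (Cmod_triangle (b - a) (a - p)). lra. }
  assert (Hcp : Cmod (c - p) <= 5 * s).
  { replace (c - p)%C with (- (a - c) + (a - p))%C by ring.
    pose proof (Cmod_triangle (- (a - c)) (a - p)) as H. rewrite Cmod_opp in H. lra. }
  rewrite E. unfold tri_int.
  replace (15 * eps * s ^ 2) with (5 * eps * s * s + 5 * eps * s * s + 5 * eps * s * s) by ring.
  eapply Rle_trans; [apply Cmod_triangle | apply Rplus_le_compat].
  eapply Rle_trans; [apply Cmod_triangle | apply Rplus_le_compat].
  all: apply Hside; trivial; lra.
Qed.

(** Iterating [tri_pick] gives triangles that shrink to a point p of the disk,
    and integrals that decrease at most like 4^-n; by differentiability at p they
    are smaller than any eps times the squared size, which is of order 4^-n
    too. *)
Lemma goursat (h : C -> C) (a b c : C) :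
  analytic_on_disk h -> unit_disk a -> unit_disk b -> unit_disk c ->
  (seg_int h a b + seg_int h b c + seg_int h c a = 0)%C.
Proof.
  intros Hh Ha Hb Hc.
  pose proof (analytic_continuous h Hh) as Hcont.
  set (T0 := (a, b, c) : triangle).
  set (r := Rmax (Cmod a) (Rmax (Cmod b) (Cmod c))).
  set (s := Rmax (Cmod (b - a)) (Rmax (Cmod (c - b)) (Cmod (a - c)))).
  assert (Hr : r < 1) by (unfold r; repeat apply Rmax_lub_lt; assumption).
  assert (HT0 : tri_bound r s T0).
  { unfold r, s. repeat split; first [apply Rmax_l | eapply Rle_trans; [ | apply Rmax_r]];
      first [apply Rmax_l | apply Rmax_r]. }
  set (T := fun n => Nat.iter n (tri_pick h) T0).
  assert (HT : forall n, tri_bound r (s * (/ 2) ^ n) (T n)).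
  { induction n as [ | n IH].
    - simpl. now rewrite Rmult_1_r.
    - replace (s * (/ 2) ^ S n) with (s * (/ 2) ^ n / 2) by (simpl; field).
      now apply tri_pick_bound. }
  assert (Hlarge : forall n, Cmod (tri_int h T0) <= 4 ^ n * Cmod (tri_int h (T n))).
  { induction n as [ | n IH].
    - simpl. lra.
    - eapply Rle_trans. apply IH.
      replace (4 ^ S n) with (4 ^ n * 4) by (simpl; ring). rewrite Rmult_assoc.
      apply Rmult_le_compat_l. apply pow_le; lra.
      apply (tri_pick_large h r _ (T n) Hcont Hr (HT n)). }
  destruct (geometric_Cauchy_C (fun n => first_vertex (T n)) s) as [p Hp].
  { intros n. apply (tri_pick_vertex h r _ (T n) (HT n)). }
  assert (Dp : unit_disk p).
  { apply Rle_lt_trans with r; trivial. apply (le_geometric _ _ (4 * s)). intros n.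
    replace p with (first_vertex (T n) + - (first_vertex (T n) - p))%C by ring.
    eapply Rle_trans. apply Cmod_triangle. rewrite Cmod_opp.
    apply Rplus_le_compat; [ | apply Hp].
    pose proof (HT n) as H. destruct (T n) as [[u v] w]. apply H. }
  destruct (Hh p Dp) as [l Hl]. rewrite is_Cderive_eps in Hl.
  change (tri_int h T0 = 0). apply Cmod_eq_0.
  apply Rle_antisym; [ | apply Cmod_ge_0].
  apply le_epsilon. intros eps Heps. rewrite Rplus_0_l.
  assert (Hs0 : 0 <= s).
  { eapply Rle_trans; [apply (Cmod_ge_0 (b - a)) | apply Rmax_l]. }
  assert (Hk : 0 < 15 * s ^ 2 + 1) by (pose proof (pow2_ge_0 s); lra).
  destruct (Hl (eps / (15 * s ^ 2 + 1))) as [d [Hd Hw]].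
  { now apply Rdiv_lt_0_compat. }
  assert (Hn : exists n, 5 * (s * (/ 2) ^ n) < d).
  { assert (L : is_lim_seq (fun n => 5 * s * (/ 2) ^ n) 0).
    { replace (Finite 0) with (Rbar_mult (5 * s) 0) by (simpl; f_equal; ring).
      apply is_lim_seq_scal_l, is_lim_seq_geom. rewrite Rabs_pos_eq; lra. }
    apply is_lim_seq_spec in L. destruct (L (mkposreal d Hd)) as [n Hn].
    exists n. specialize (Hn n (le_n n)). simpl in Hn.
    rewrite Rminus_0_r in Hn. apply Rle_lt_trans with (2 := Hn).
    rewrite <- Rmult_assoc. apply Rle_abs. }
  destruct Hn as [n Hn].
  assert (Hsmall : Cmod (tri_int h (T n))
    <= 15 * (eps / (15 * s ^ 2 + 1)) * (s * (/ 2) ^ n) ^ 2).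
  { apply (tri_int_differentiable h p l _ d r _ (T n)); trivial.
    - apply Rlt_le. now apply Rdiv_lt_0_compat.
    - rewrite <- Rmult_assoc. apply Hp. }
  eapply Rle_trans. apply (Hlarge n).
  eapply Rle_trans. apply Rmult_le_compat_l; [apply pow_le; lra | apply Hsmall].
  replace (4 ^ n * (15 * (eps / (15 * s ^ 2 + 1)) * (s * (/ 2) ^ n) ^ 2))
    with (eps / (15 * s ^ 2 + 1) * (15 * s ^ 2) * (4 ^ n * ((/ 2) ^ n * (/ 2) ^ n))) by ring.
  rewrite <- !Rpow_mult_distr. replace (4 * (/ 2 * / 2)) with 1 by field.
  rewrite pow1, Rmult_1_r.
  apply Rle_trans with (eps / (15 * s ^ 2 + 1) * (15 * s ^ 2 + 1)).
  - apply Rmult_le_compat_l; [ | lra]. apply Rlt_le. now apply Rdiv_lt_0_compat.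
  - right. field. lra.
Qed.

(** By Goursat on the triangle 0, w, z the increment of the radial integral from
    w to z is the integral over [w, z], and h is nearly h w there. *)
Lemma segment_integral_derive (h : C -> C) (w : C) :
  analytic_on_disk h -> unit_disk w -> is_Cderive (segment_integral h) w (h w).
Proof.
  intros Hh Hw.
  pose proof (analytic_continuous h Hh) as Hcont.
  assert (D0 : unit_disk 0) by (unfold unit_disk; rewrite Cmod_0; lra).
  apply is_Cderive_eps. intros eps Heps.
  destruct (proj1 (continuous_C_eps h w) (Hcont w Hw) eps Heps) as [d [Hd Hd']].
  exists (Rmin (d / 2) (1 - Cmod w)). split.
  { apply Rmin_glb_lt. lra. unfold unit_disk in Hw; lra. }
  intros z Hz.
  pose proof (Rmin_l (d / 2) (1 - Cmod w)). pose proof (Rmin_r (d / 2) (1 - Cmod w)).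
  assert (Dz : unit_disk z).
  { unfold unit_disk. replace z with (w + (z - w))%C by ring.
    eapply Rle_lt_trans. apply Cmod_triangle. lra. }
  set (const := fun _ : C => h w).
  assert (Hconst : continuous_on_disk const) by (intros t _; apply continuous_const).
  assert (Hprim : forall t, unit_disk t -> is_Cderive (fun z => 0 + h w * z)%C t (const t)).
  { intros t _. apply is_Cderive_affine. }
  rewrite !segment_integral_seg_int.
  replace (seg_int h 0 z - seg_int h 0 w - h w * (z - w))%C
    with (seg_int (fun t => h t - const t)%C w z).
  2:{ rewrite seg_int_minus, (seg_int_primitive _ const w z Hconst Hprim) by trivial.
      pose proof (goursat h 0 w z Hh D0 Hw Dz) as G.
      rewrite (seg_int_swap h 0 z) in G by trivial.
      replace (seg_int h w z) with (seg_int h 0 z - seg_int h 0 w + (seg_int h 0 w + seg_int h w z + - seg_int h 0 z))%C by ring.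
      rewrite G. ring. }
  apply Cmod_seg_int_le; trivial.
  - intros t Ht. apply continuous_Cplus. now apply Hcont. apply continuous_const.
  - intros s Hs. apply Hd'.
    apply Rle_lt_trans with (d / 2); [ | lra].
    apply Cmod_convex; trivial; [ | lra].
    replace (w - w)%C with (RtoC 0) by ring. rewrite Cmod_0. lra.
Qed.

(** * A mean value inequality along lines *)

Lemma is_derive_Re (F : R -> C) (t : R) (l : C) :
  @is_derive R_AbsRing C_R_NormedModule F t l -> is_derive (fun s => Re (F s)) t (Re l).
Proof.
  intros H. unfold is_derive in *.
  apply (filterdiff_ext_lin (fun s => Re (F s)) (fun y => Re (scal y l : C_R_NormedModule))).
  - apply (filterdiff_comp' (U := R_NormedModule) (V := C_R_NormedModule) (W := R_NormedModule) F Re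
      t (fun y => scal y l) Re H).
    apply (filterdiff_linear (U := C_R_NormedModule) (V := R_NormedModule)).
    apply (is_linear_fst (U := R_NormedModule) (V := R_NormedModule)).
  - intros y. reflexivity.
Qed.

(** Rotating by the unit number u that makes the increment of K real reduces the
    inequality to the monotonicity of the real function phi - Re (u K). *)
Lemma increment_le_along_line (K dK : C -> C) (a b : C) (phi dphi : R -> R) (S T : R) :
  S <= T ->
  (forall t, S <= t <= T -> is_Cderive K (a + t * b)%C (dK (a + t * b)%C)) ->
  (forall t, S <= t <= T -> is_derive phi t (dphi t)) ->
  (forall t, S <= t <= T -> Cmod (dK (a + t * b)%C * b) <= dphi t) ->
  Cmod (K (a + T * b)%C - K (a + S * b)%C) <= phi T - phi S.
Proof.
  intros HST HK Hphi Hle.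
  set (D := (K (a + T * b) - K (a + S * b))%C).
  destruct (Req_dec (Cmod D) 0) as [E0 | N0].
  - rewrite E0.
    destruct (MVT_gen phi S T dphi) as [c [Hc E]].
    + intros x. rewrite Rmin_left, Rmax_right by lra. intros Hx. apply Hphi; lra.
    + intros x. rewrite Rmin_left, Rmax_right by lra. intros Hx.
      apply continuity_pt_filterlim, (ex_derive_continuous (V := R_NormedModule)).
      exists (dphi x). now apply Hphi.
    + rewrite Rmin_left, Rmax_right in Hc by lra. rewrite E.
      apply Rmult_le_pos; [ | lra]. eapply Rle_trans; [apply Cmod_ge_0 | apply Hle]; lra.
  - set (u := (Cconj D / Cmod D)%C).
    assert (Nz : RtoC (Cmod D) <> 0) by (intros H; apply RtoC_inj in H; tauto).
    assert (Hu : Cmod u = 1).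
    { unfold u. rewrite Cmod_div, Cmod_conj, Cmod_R, Rabs_pos_eq by (try apply Cmod_ge_0; trivial).
      now apply Rinv_r. }
    assert (HuD : (u * D = Cmod D)%C).
    { unfold u. replace (Cconj D / Cmod D * D)%C with (D * Cconj D / Cmod D)%C by (field; trivial).
      rewrite <- Cmod2_conj, RtoC_pow. field. trivial. }
    set (rho := fun t : R => Re (u * K (a + t * b))%C).
    set (drho := fun t : R => Re (u * dK (a + t * b) * b)%C).
    assert (Hrho : forall t, S <= t <= T -> is_derive rho t (drho t)).
    { intros t Ht. apply (is_derive_Re (fun t : R => u * K (a + t * b))%C).
      apply (is_derive_along_line (fun w => u * K w)%C).
      replace (u * dK (a + t * b))%C with (0 * K (a + t * b) + u * dK (a + t * b))%C by ring.
      apply (is_Cderive_mult (fun _ => u) K); [ | now apply HK].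
      apply (is_derive_const (K := C_AbsRing) (V := C_NormedModule)). }
    destruct (MVT_gen (fun t => phi t - rho t) S T (fun t => dphi t - drho t)) as [c [Hc E]].
    + intros x. rewrite Rmin_left, Rmax_right by lra. intros Hx.
      apply (is_derive_minus (K := R_AbsRing) (V := R_NormedModule));
        [apply Hphi | apply Hrho]; lra.
    + intros x. rewrite Rmin_left, Rmax_right by lra. intros Hx.
      apply continuity_pt_filterlim,
        (ex_derive_continuous (V := R_NormedModule) (fun t => phi t - rho t)).
      exists (dphi x - drho x).
      apply (is_derive_minus (K := R_AbsRing) (V := R_NormedModule));
        [apply Hphi | apply Hrho]; lra.
    + rewrite Rmin_left, Rmax_right in Hc by lra.
      assert (Hd : drho c <= dphi c).
      { unfold drho. eapply Rle_trans; [apply Rle_abs | ].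
        eapply Rle_trans; [apply re_le_Cmod | ].
        rewrite <- Cmult_assoc, Cmod_mult, Hu, Rmult_1_l. now apply Hle. }
      assert (Hge : 0 <= (dphi c - drho c) * (T - S)) by (apply Rmult_le_pos; lra).
      rewrite <- E in Hge.
      assert (Hr : rho T - rho S = Cmod D).
      { unfold rho. transitivity (Re (u * D)%C).
        - unfold D. simpl. ring.
        - rewrite HuD. reflexivity. }
      lra.
Qed.

(** * Exponential and logarithm *)

Lemma Cauchy_Riemann (u v : R -> R -> R) (x y p q : R) :
  differentiable_pt_lim u x y p (- q) -> differentiable_pt_lim v x y q p ->
  is_Cderive (fun z => (u (Re z) (Im z), v (Re z) (Im z))) (x, y) (p, q).
Proof.
  intros Hu Hv. apply is_Cderive_eps. intros eps Heps.
  assert (He2 : 0 < eps / 2) by lra.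
  destruct (Hu (mkposreal _ He2)) as [d1 H1]. destruct (Hv (mkposreal _ He2)) as [d2 H2].
  exists (Rmin d1 d2). split. { apply Rmin_glb_lt; apply cond_pos. }
  intros [s t] Hw. simpl Re. simpl Im.
  assert (M : Rmax (Rabs (s - x)) (Rabs (t - y)) <= Cmod ((s, t) - (x, y))) by apply (Rmax_Cmod ((s, t) - (x, y))%C).
  pose proof (Rmax_l (Rabs (s - x)) (Rabs (t - y))). pose proof (Rmax_r (Rabs (s - x)) (Rabs (t - y))).
  pose proof (Rmin_l d1 d2). pose proof (Rmin_r d1 d2).
  eapply Rle_trans. apply Cmod_le_Re_Im.
  replace (eps * Cmod ((s, t) - (x, y))) with
    (eps / 2 * Cmod ((s, t) - (x, y)) + eps / 2 * Cmod ((s, t) - (x, y))) by field.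
  apply Rplus_le_compat.
  - eapply Rle_trans; [ | apply Rmult_le_compat_l; [lra | apply M]].
    eapply Rle_trans; [ | apply H1; lra]. right. f_equal. simpl. ring.
  - eapply Rle_trans; [ | apply Rmult_le_compat_l; [lra | apply M]].
    eapply Rle_trans; [ | apply H2; lra]. right. f_equal. simpl. ring.
Qed.
(** Differentiability in two variables when one partial derivative is
    continuous and the other one only exists. *)
Lemma differentiable_pt_lim_partials (f : R -> R -> R) (dfx : R -> R -> R) (x y dfy : R) :
  locally (x, y) (fun p : R * R => is_derive (fun s => f s (snd p)) (fst p) (dfx (fst p) (snd p))) ->
  is_derive (fun t => f x t) y dfy ->
  continuous (fun p : R * R => dfx (fst p) (snd p)) (x, y) ->
  differentiable_pt_lim f x y (dfx x y) dfy.
Proof.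
  intros H1 H2 H3. apply filterdiff_differentiable_pt_lim.
  exact (is_derive_filterdiff f x y dfx dfy H1 H2 H3).
Qed.

Definition Cexp (z : C) : C := (exp (Re z) * cos (Im z), exp (Re z) * sin (Im z)).

Lemma continuous_real (f : R -> R) {U : UniformSpace} (g : U -> R) (p : U) :
  continuous g p -> ex_derive f (g p) -> continuous (fun t => f (g t)) p.
Proof.
  intros Hg Hf. apply continuous_comp; trivial.
  now apply (ex_derive_continuous (V := R_NormedModule)).
Qed.

Lemma is_Cderive_Cexp (z : C) : is_Cderive Cexp z (Cexp z).
Proof.
  destruct z as [x y].
  apply (Cauchy_Riemann (fun x y => exp x * cos y) (fun x y => exp x * sin y)).
  - apply (differentiable_pt_lim_partials _ (fun x y => exp x * cos y)).
    + apply filter_forall. intros [s t]. simpl. auto_derive; trivial. ring.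
    + simpl. auto_derive; trivial. ring.
    + apply (continuous_mult (K := R_AbsRing)); apply continuous_real.
      apply continuous_fst. auto_derive; trivial. apply continuous_snd. auto_derive; trivial.
  - apply (differentiable_pt_lim_partials _ (fun x y => exp x * sin y)).
    + apply filter_forall. intros [s t]. simpl. auto_derive; trivial. ring.
    + simpl. auto_derive; trivial. ring.
    + apply (continuous_mult (K := R_AbsRing)); apply continuous_real.
      apply continuous_fst. auto_derive; trivial. apply continuous_snd. auto_derive; trivial.
Qed.

Lemma Cmod_Cexp (z : C) : Cmod (Cexp z) = exp (Re z).
Proof.
  unfold Cexp, Cmod; simpl.
  replace (_ + _) with (Rsqr (exp (Re z)) * (Rsqr (sin (Im z)) + Rsqr (cos (Im z)))) by (unfold Rsqr; ring).
  rewrite sin2_cos2, Rmult_1_r. apply sqrt_Rsqr. apply Rlt_le, exp_pos.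
Qed.

Lemma Cexp_opp_r (z : C) : (Cexp z * Cexp (- z) = 1)%C.
Proof.
  destruct z as [x y]. unfold Cexp, Cmult, RtoC; simpl.
  rewrite cos_neg, sin_neg, exp_Ropp. pose proof (exp_pos x).
  pose proof (sin2_cos2 y) as E. unfold Rsqr in E.
  f_equal; field_simplify; try lra.
Qed.

(** Principal branch on the right half plane, where the argument is
    atan (Im / Re). *)
Definition Clog (z : C) : C := (ln (Cmod z), atan (Im z / Re z)).

Lemma is_Cderive_Clog (z : C) : 0 < Re z -> is_Cderive Clog z (/ z)%C.
Proof.
  destruct z as [x y]. simpl Re. intros Hx.
  assert (N : forall s t, 0 < s -> 0 < s ^ 2 + t ^ 2).
  { intros s t Hs. pose proof (pow2_ge_0 t). pose proof (pow_lt s 2 Hs). lra. }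
  assert (L : locally (x, y) (fun p : R * R => 0 < fst p)).
  { apply (continuous_fst (U := R_UniformSpace) (V := R_UniformSpace) x y (fun s => 0 < s)).
    now apply (locally_open (fun s => 0 < s) _ (open_gt 0) (fun s H => H)). }
  assert (CN : continuous (fun p : R * R => / (fst p ^ 2 + snd p ^ 2)) (x, y)).
  { apply (continuous_real Rinv (fun p : R * R => fst p ^ 2 + snd p ^ 2)).
    - apply (continuous_plus (V := R_NormedModule)); apply (continuous_real (fun s => s ^ 2)).
      apply continuous_fst. auto_derive; trivial. apply continuous_snd. auto_derive; trivial.
    - simpl. auto_derive; trivial. pose proof (N x y Hx). simpl in *. lra. }
  apply (is_derive_ext_loc (K := C_AbsRing) (V := C_NormedModule)
    (fun z => (ln (sqrt (Re z ^ 2 + Im z ^ 2)), atan (Im z / Re z)))).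
  { apply filter_forall. intros z. reflexivity. }
  replace (/ (x, y))%C with (x / (x ^ 2 + y ^ 2), (- y) / (x ^ 2 + y ^ 2)) by reflexivity.
  apply (Cauchy_Riemann (fun x y => ln (sqrt (x ^ 2 + y ^ 2))) (fun x y => atan (y / x))).
  - apply (differentiable_pt_lim_partials _ (fun x y => x / (x ^ 2 + y ^ 2))).
    + apply filter_imp with (2 := L). intros [s t] H. simpl fst in *. simpl snd in *.
      pose proof (N s t H) as Hn. 
      pose proof (sqrt_lt_R0 _ Hn) as Hr. pose proof (sqrt_sqrt _ (Rlt_le _ _ Hn)) as Er.
      auto_derive.
      * repeat split; simpl in *; lra.
      * simpl pow in *. rewrite <- Er at 3. field. lra.
    + pose proof (N x y Hx) as Hn. 
      pose proof (sqrt_lt_R0 _ Hn) as Hr. pose proof (sqrt_sqrt _ (Rlt_le _ _ Hn)) as Er.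
      auto_derive.
      * repeat split; simpl in *; lra.
      * simpl pow in *. rewrite <- Er at 3. field. lra.
    + apply (continuous_mult (K := R_AbsRing)); trivial. apply continuous_fst.
  - apply (differentiable_pt_lim_partials _ (fun x y => - y / (x ^ 2 + y ^ 2))).
    + apply filter_imp with (2 := L). intros [s t] H. simpl fst in *. simpl snd in *.
      pose proof (N s t H) as Hn. 
      auto_derive. lra. 
      unfold Rsqr. simpl in *. field. repeat split; lra.
    + pose proof (N x y Hx) as Hn. 
      auto_derive. lra. unfold Rsqr. simpl in *. field. repeat split; lra.
    + apply (continuous_mult (K := R_AbsRing)); trivial.
      apply (continuous_opp (V := R_NormedModule)), continuous_snd.
Qed.

Lemma Cexp_Clog (z : C) : 0 < Re z -> Cexp (Clog z) = z.
Proof.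
  destruct z as [x y]. simpl Re. intros Hx. unfold Cexp, Clog. simpl.
  assert (Hn : 0 < Cmod (x, y)).
  { apply Cmod_gt_0. intros H. injection H as H _. lra. }
  rewrite exp_ln by trivial. rewrite cos_atan, sin_atan.
  assert (E : Cmod (x, y) = x * sqrt (1 + (y / x)²)).
  { unfold Cmod. simpl fst. simpl snd. rewrite <- (sqrt_Rsqr x) at 2 by lra.
    rewrite <- sqrt_mult by (pose proof (Rle_0_sqr x); pose proof (Rle_0_sqr (y / x)); lra).
    f_equal. unfold Rsqr. field. lra. }
  assert (Hs : sqrt (1 + (y / x)²) <> 0).
  { intros H. rewrite E, H in Hn. lra. }
  rewrite E. f_equal; field; repeat split; trivial; lra.
Qed.

Lemma Clog_Cexp (z : C) : - (PI / 2) < Im z < PI / 2 -> Clog (Cexp z) = z.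
Proof.
  intros Hz. unfold Clog. rewrite Cmod_Cexp, ln_exp. unfold Cexp. simpl.
  assert (Hc : 0 < cos (Im z)) by (apply cos_gt_0; lra).
  replace (exp (Re z) * sin (Im z) / (exp (Re z) * cos (Im z))) with (tan (Im z)).
  - rewrite atan_tan by lra. now destruct z.
  - unfold tan. field. pose proof (exp_pos (Re z)). lra.
Qed.

(** * The weight on the half strip *)

Lemma Rabs_atan_le (t : R) : Rabs (atan t) <= Rabs t.
Proof.
  destruct (MVT_gen atan 0 t (fun c => / (1 + c ^ 2))) as [c [_ E]].
  - intros x _. auto_derive; trivial. unfold Rsqr. field. nra.
  - intros x _. apply derivable_continuous_pt, derivable_pt_atan.
  - rewrite atan_0, !Rminus_0_r in E. rewrite E, Rabs_mult.
    rewrite <- (Rmult_1_l (Rabs t)) at 2.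
    apply Rmult_le_compat_r. apply Rabs_pos.
    pose proof (pow2_ge_0 c).
    rewrite Rabs_pos_eq by (apply Rlt_le, Rinv_0_lt_compat; lra).
    rewrite <- Rinv_1. apply Rinv_le_contravar; lra.
Qed.

Lemma exp_le (x y : R) : x <= y -> exp x <= exp y.
Proof. intros [H | ->]; [now left; apply exp_increasing | apply Rle_refl]. Qed.

(** The factor 1/2 in front of z keeps the exponent 1 + y/2 positive for all y in
    the strip |y| < pi/2, hence the weight bounded; it still exceeds 1 for y > 0,
    which makes the weight integrable there. *)
Definition weight (z : C) : C := Cexp (- ((1 - Ci / 2 * z) * Clog (z + 1))).

Lemma Cmod_weight (x y : R) :
  Cmod (weight (x, y)) =
  exp (- ((1 + y / 2) * ln (Cmod (x + 1, y)) + x / 2 * atan (y / (x + 1)))).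
Proof.
  unfold weight. rewrite Cmod_Cexp. f_equal. unfold Clog.
  replace ((x, y) + 1)%C with (x + 1, y).
  2:{ apply injective_projections; simpl; ring. }
  replace (1 - Ci / 2 * (x, y))%C with (1 + y / 2, - x / 2).
  2:{ apply injective_projections; simpl; field. }
  simpl. field.
Qed.

Lemma Cmod_weight_real (x : R) : 0 <= x -> Cmod (weight x) = / (1 + x).
Proof.
  intros Hx. unfold RtoC at 1. rewrite Cmod_weight.
  change (x + 1, 0) with (RtoC (x + 1)). rewrite Cmod_R, Rabs_pos_eq by lra.
  replace (0 / (x + 1)) with 0 by (field; lra). rewrite atan_0.
  replace (- ((1 + 0 / 2) * ln (x + 1) + x / 2 * 0)) with (- ln (1 + x)).
  - rewrite exp_Ropp, exp_ln; lra.
  - rewrite (Rplus_comm 1 x). field.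
Qed.

Lemma ln_Cmod_ge (x y : R) : 0 <= x -> ln (1 + x) <= ln (Cmod (x + 1, y)).
Proof.
  intros Hx. apply ln_le; [lra | ].
  pose proof (re_le_Cmod (x + 1, y)) as H. simpl in H.
  rewrite Rabs_pos_eq in H; lra.
Qed.

(** The logarithmic part of the exponent is nonpositive, and
    |atan (y / (x + 1))| <= |y| / (x + 1) bounds the other part by 1. *)
Lemma Cmod_weight_le (x y : R) : 0 <= x -> -2 <= y <= 2 -> Cmod (weight (x, y)) <= exp 1.
Proof.
  intros Hx Hy. rewrite Cmod_weight.
  pose proof (ln_Cmod_ge x y Hx) as HL.
  assert (H0 : 0 <= ln (1 + x)) by (rewrite <- ln_1; apply ln_le; lra).
  assert (H1 : 0 <= (1 + y / 2) * ln (Cmod (x + 1, y))) by (apply Rmult_le_pos; lra).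
  assert (H2 : Rabs (x / 2 * atan (y / (x + 1))) <= 1).
  { rewrite Rabs_mult. apply Rle_trans with (x / 2 * Rabs (y / (x + 1))).
    - rewrite (Rabs_pos_eq (x / 2)) by lra. apply Rmult_le_compat_l; [lra | apply Rabs_atan_le].
    - unfold Rdiv. rewrite Rabs_mult, Rabs_inv, (Rabs_pos_eq (x + 1)) by lra.
      assert (Hy' : Rabs y <= 2) by (apply Rabs_le; lra).
      apply Rmult_le_reg_r with (x + 1). lra.
      replace (x * / 2 * (Rabs y * / (x + 1)) * (x + 1)) with (x * Rabs y / 2) by (field; lra).
      pose proof (Rabs_pos y). nra. }
  apply exp_le. apply Rabs_le_between in H2. lra.
Qed.

Lemma Cmod_weight_upper (x : R) : 0 <= x -> Cmod (weight (x, 1)) <= exp (- (3 / 2 * ln (1 + x))).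
Proof.
  intros Hx. rewrite Cmod_weight. apply exp_le.
  pose proof (ln_Cmod_ge x 1 Hx) as HL.
  assert (H : 0 <= x / 2 * atan (1 / (x + 1))).
  { apply Rmult_le_pos; [lra | ]. rewrite <- atan_0. apply Rlt_le, atan_increasing.
    apply Rdiv_lt_0_compat; lra. }
  lra.
Qed.

(** * Transfer to the disk *)

(** [zeta] is Log (2 / (1 + z)), written without a division so that only [Clog]
    has to be differentiated; [unzeta] is its inverse on the half strip. *)
Definition zeta (z : C) : C := (- Clog ((1 + z) / 2))%C.
Definition unzeta (s : C) : C := (2 * Cexp (- s) - 1)%C.
(** This is weight (zeta z) times zeta'(z) = - 1 / (1 + z), where 1 / (1 + z) is
    rewritten as Cexp (zeta z) / 2. *)
Definition gprime (z : C) : C := (- (1 / 2) * weight (zeta z) * Cexp (zeta z))%C.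

(** Both sides say that v is in the disk with diameter [0, 1]. *)
Lemma unit_disk_half (v : C) : unit_disk (2 * v - 1) <-> Cmod v ^ 2 < Re v.
Proof.
  rewrite Cmod2_alt.
  assert (E : Cmod (2 * v - 1) ^ 2 = 1 - 4 * (Re v - (Re v ^ 2 + Im v ^ 2))).
  { rewrite Cmod2_alt. destruct v as [x y]. simpl. ring. }
  pose proof (Cmod_ge_0 (2 * v - 1)) as H0. unfold unit_disk.
  set (c := Cmod (2 * v - 1)) in *. set (d := Re v ^ 2 + Im v ^ 2) in *.
  clearbody c d. generalize dependent (Re v). intros r E. 
  split; intros H.
  - assert (Hc : c * c <= c * 1) by (apply Rmult_le_compat_l; lra). simpl in E. lra.
  - destruct (Rlt_or_le c 1) as [|Hc]; trivial. assert (H1 : c * 1 <= c * c) by (apply Rmult_le_compat_l; lra).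
    simpl in E. lra.
Qed.

Lemma unit_disk_right_half (z : C) : unit_disk z -> 0 < Re ((1 + z) / 2) /\ Cmod ((1 + z) / 2) < 1.
Proof.
  intros Hz. set (v := ((1 + z) / 2)%C).
  replace z with (2 * v - 1)%C in Hz by (unfold v; field).
  apply unit_disk_half in Hz.
  pose proof (re_le_Cmod v) as H. pose proof (Rle_abs (Re v)).
  pose proof (pow2_ge_0 (Cmod v)). split; [lra | ].
  nra.
Qed.

Lemma unzeta_zeta (z : C) : unit_disk z -> unzeta (zeta z) = z.
Proof.
  intros Hz. unfold unzeta, zeta.
  replace (- - Clog ((1 + z) / 2))%C with (Clog ((1 + z) / 2)) by ring.
  rewrite Cexp_Clog by now apply unit_disk_right_half. field.
Qed.

Lemma zeta_unzeta (s : C) : - (PI / 2) < Im s < PI / 2 -> zeta (unzeta s) = s.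
Proof.
  intros Hs. unfold zeta, unzeta.
  replace ((1 + (2 * Cexp (- s) - 1)) / 2)%C with (Cexp (- s)) by field.
  rewrite Clog_Cexp. ring. change (Im (- s)) with (- Im s). lra.
Qed.

Lemma unit_disk_unzeta (s : C) : unit_disk (unzeta s) <-> 1 < exp (Re s) * cos (Im s).
Proof.
  unfold unzeta. rewrite unit_disk_half, Cmod_Cexp.
  change (Re (Cexp (- s))) with (exp (- Re s) * cos (- Im s)).
  change (Re (- s)) with (- Re s).
  rewrite cos_neg, exp_Ropp. pose proof (exp_pos (Re s)) as He.
  set (e := exp (Re s)) in *. set (c := cos (Im s)).
  replace ((/ e) ^ 2) with (1 * (/ e * / e)) by ring.
  replace (/ e * c) with (e * c * (/ e * / e)) by (field; lra).
  assert (Hi : 0 < / e * / e) by (apply Rmult_lt_0_compat; now apply Rinv_0_lt_compat).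
  split; intros H.
  - now apply Rmult_lt_reg_r in H.
  - now apply Rmult_lt_compat_r.
Qed.

Lemma zeta_range (z : C) : unit_disk z ->
  0 < Re (zeta z) /\ - (PI / 2) < Im (zeta z) < PI / 2.
Proof.
  intros Hz. destruct (unit_disk_right_half z Hz) as [H1 H2].
  assert (H0 : 0 < Cmod ((1 + z) / 2)).
  { eapply Rlt_le_trans. apply H1. eapply Rle_trans. apply Rle_abs. apply re_le_Cmod. }
  unfold zeta. set (v := ((1 + z) / 2)%C) in *. split.
  - change (0 < - ln (Cmod v)). rewrite <- Ropp_0. apply Ropp_lt_contravar. rewrite <- ln_1. now apply ln_increasing.
  - change (- (PI / 2) < - atan (Im v / Re v) < PI / 2).
    pose proof (atan_bound (Im v / Re v)). lra.
Qed.

Lemma ex_Cderive_mult (f g : C -> C) (z : C) :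
  @ex_derive C_AbsRing C_NormedModule f z -> @ex_derive C_AbsRing C_NormedModule g z ->
  @ex_derive C_AbsRing C_NormedModule (fun w => f w * g w)%C z.
Proof.
  intros [l Hl] [m Hm]. eexists. apply is_Cderive_mult; eassumption.
Qed.

Lemma is_Cderive_opp (z : C) : is_Cderive Copp z (- (1))%C.
Proof.
  apply is_Cderive_slope. exists (fun _ => (- (1))%C). repeat split.
  - apply continuous_const.
  - intros w. ring.
Qed.

Lemma ex_derive_zeta (z : C) : unit_disk z -> @ex_derive C_AbsRing C_NormedModule zeta z.
Proof.
  intros Hz. eexists. apply (is_Cderive_comp Copp (fun w => Clog ((1 + w) / 2)%C)).
  apply is_Cderive_opp.
  apply (is_Cderive_comp Clog (fun w => (1 + w) / 2)%C).
  - now apply is_Cderive_Clog, unit_disk_right_half.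
  - apply is_Cderive_slope. exists (fun _ => / 2)%C. repeat split.
    + apply continuous_const.
    + intros w. field.
Qed.

Lemma ex_derive_weight (s : C) : 0 < Re s -> @ex_derive C_AbsRing C_NormedModule weight s.
Proof.
  intros Hs. eexists.
  apply (is_Cderive_comp Cexp (fun z => - ((1 - Ci / 2 * z) * Clog (z + 1)))%C).
  apply is_Cderive_Cexp.
  apply (is_Cderive_comp Copp (fun z => (1 - Ci / 2 * z) * Clog (z + 1))%C).
  apply is_Cderive_opp.
  apply (is_Cderive_mult (fun z => 1 - Ci / 2 * z)%C (fun z => Clog (z + 1))).
  - apply is_Cderive_slope. exists (fun _ => - (Ci / 2))%C. repeat split.
    + apply continuous_const.
    + intros w. ring.
  - apply (is_Cderive_comp Clog (fun z => z + 1)%C).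
    + apply is_Cderive_Clog. change (0 < Re s + 1). lra.
    + apply is_Cderive_slope. exists (fun _ => RtoC 1). repeat split.
      * apply continuous_const.
      * intros w. ring.
Qed.

Lemma analytic_gprime : analytic_on_disk gprime.
Proof.
  intros z Hz. unfold gprime.
  destruct (ex_derive_zeta z Hz) as [l Hl].
  destruct (ex_derive_weight (zeta z)) as [m Hm]. now apply zeta_range.
  apply ex_Cderive_mult; [apply ex_Cderive_mult | ].
  - apply (ex_derive_const (K := C_AbsRing) (V := C_NormedModule)).
  - eexists. apply (is_Cderive_comp weight zeta); eassumption.
  - eexists. apply (is_Cderive_comp Cexp zeta); [apply is_Cderive_Cexp | eassumption].
Qed.

Lemma Cmod_gprime (z : C) : unit_disk z -> Cmod (gprime z) = Cmod (weight (zeta z)) / Cmod (1 + z).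
Proof.
  intros Hz. destruct (unit_disk_right_half z Hz) as [H1 _].
  assert (Hn : 0 < Cmod ((1 + z) / 2)).
  { eapply Rlt_le_trans. apply H1. eapply Rle_trans. apply Rle_abs. apply re_le_Cmod. }
  assert (Hhalf : Cmod ((1 + z) / 2) = Cmod (1 + z) / 2).
  { rewrite Cmod_div by apply C2_neq_0. rewrite Cmod_R, Rabs_pos_eq by lra. reflexivity. }
  assert (E : Cmod (Cexp (zeta z)) = / (Cmod (1 + z) / 2)).
  { rewrite Cmod_Cexp. change (Re (zeta z)) with (- ln (Cmod ((1 + z) / 2))).
    rewrite exp_Ropp, exp_ln by trivial. now rewrite Hhalf. }
  unfold gprime. rewrite !Cmod_mult, Cmod_opp, E.
  rewrite Cmod_div by apply C2_neq_0. rewrite !Cmod_R, (Rabs_pos_eq 1), (Rabs_pos_eq 2) by lra.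
  field. lra.
Qed.

(** In the variable s = zeta z the factor zeta' disappears and g' dz becomes
    weight s ds. *)
Lemma is_Cderive_pullback (f H : C -> C) (s : C) :
  (forall z, unit_disk z -> is_Cderive H z (f z * gprime z)%C) ->
  - (PI / 2) < Im s < PI / 2 -> 1 < exp (Re s) * cos (Im s) ->
  is_Cderive (fun s => H (unzeta s)) s (f (unzeta s) * weight s)%C.
Proof.
  intros HH Hs1 Hs2. apply unit_disk_unzeta in Hs2.
  replace (f (unzeta s) * weight s)%C
    with ((f (unzeta s) * gprime (unzeta s)) * (2 * (Cexp (- s) * - (1))))%C.
  2:{ unfold gprime. rewrite zeta_unzeta by trivial.
      transitivity (f (unzeta s) * weight s * (Cexp s * Cexp (- s)))%C; [field | ].
      rewrite Cexp_opp_r. ring. }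
  apply (is_Cderive_comp H unzeta); [now apply HH | ].
  apply (is_Cderive_comp (fun w => 2 * w - 1)%C (fun s => Cexp (- s))).
  - apply is_Cderive_slope. exists (fun _ => RtoC 2). repeat split.
    + apply continuous_const.
    + intros w. ring.
  - apply (is_Cderive_comp Cexp Copp); [apply is_Cderive_Cexp | apply is_Cderive_opp].
Qed.

(** * Boundedness of the operator *)

Lemma cos_1_gt_half : 1 / 2 < cos 1.
Proof.
  rewrite <- cos_PI3. pose proof PI2_3_2. pose proof PI_4.
  apply cos_decreasing_1; lra.
Qed.

(** The superlevel sets of the cosine on (-pi/2, pi/2) are intervals, so a
    vertical segment stays in the image of the disk once its endpoints do. *)
Lemma cos_between (c y1 y2 y : R) :
  - (PI / 2) < y1 -> y2 < PI / 2 -> y1 <= y <= y2 ->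
  c < cos y1 -> c < cos y2 -> c < cos y.
Proof.
  intros H1 H2 Hy Hc1 Hc2. pose proof PI_RGT_0.
  destruct (Rle_or_lt 0 y) as [Hp | Hn].
  - apply Rlt_le_trans with (1 := Hc2). apply cos_decr_1; lra.
  - apply Rlt_le_trans with (1 := Hc1). rewrite <- (cos_neg y1), <- (cos_neg y).
    apply cos_decr_1; lra.
Qed.

Lemma vertical_bound (f H : C -> C) (M x y1 y2 : R) :
  (forall z, unit_disk z -> Cmod (f z) <= M) ->
  (forall z, unit_disk z -> is_Cderive H z (f z * gprime z)%C) ->
  0 <= x -> y1 <= y2 -> - (PI / 2) < y1 -> y2 < PI / 2 ->
  1 < exp x * cos y1 -> 1 < exp x * cos y2 ->
  Cmod (H (unzeta (x, y2)) - H (unzeta (x, y1))) <= M * exp 1 * (y2 - y1).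
Proof.
  intros HM HH Hx Hy H1 H2 Hc1 Hc2.
  assert (Hpt : forall t : R, ((x, 0) + t * Ci)%C = (x, t)).
  { intros t. apply injective_projections; simpl; ring. }
  assert (Hin : forall t, y1 <= t <= y2 -> 1 < exp x * cos t).
  { intros t Ht. pose proof (exp_pos x) as He.
    assert (Hi : forall c, 1 < exp x * c <-> / exp x < c).
    { intros c. split; intros Hc.
      - apply Rmult_lt_reg_l with (exp x); trivial. rewrite Rinv_r; lra.
      - rewrite <- (Rinv_r (exp x)) by lra. now apply Rmult_lt_compat_l. }
    apply Hi. apply (cos_between _ y1 y2); trivial; now apply Hi. }
  rewrite <- (Hpt y1), <- (Hpt y2).
  replace (M * exp 1 * (y2 - y1)) with (M * exp 1 * y2 - M * exp 1 * y1) by ring.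
  apply (increment_le_along_line (fun s => H (unzeta s)) (fun s => f (unzeta s) * weight s)%C (x, 0) Ci (fun t => M * exp 1 * t) (fun _ => M * exp 1)); trivial.
  - intros t Ht. rewrite Hpt. apply is_Cderive_pullback; trivial; simpl. lra. now apply Hin.
  - intros t _. auto_derive; trivial. ring.
  - intros t Ht. rewrite Hpt. rewrite !Cmod_mult, Cmod_Ci, Rmult_1_r.
    apply Rmult_le_compat; try apply Cmod_ge_0.
    + apply HM, unit_disk_unzeta. simpl. now apply Hin.
    + apply Cmod_weight_le; trivial. pose proof PI_4. lra.
Qed.

(** The line Im = 1 starts at ln 2 because the image of the disk contains
    x + i as soon as exp x >= 2.  The bound 2 M is the total increment of the
    majorant -2 M (1 + t) ^ (-1/2), a primitive of M (1 + t) ^ (-3/2). *)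
Lemma horizontal_bound (f H : C -> C) (M x : R) :
  (forall z, unit_disk z -> Cmod (f z) <= M) ->
  (forall z, unit_disk z -> is_Cderive H z (f z * gprime z)%C) ->
  0 <= M -> ln 2 <= x ->
  Cmod (H (unzeta (x, 1)) - H (unzeta (ln 2, 1))) <= 2 * M.
Proof.
  intros HM HH HM0 Hx.
  assert (Hl : 0 < ln 2) by (rewrite <- ln_1; apply ln_increasing; lra).
  assert (Hpt : forall t : R, (Ci + t * 1)%C = (t, 1)).
  { intros t. apply injective_projections; simpl; ring. }
  rewrite <- (Hpt x), <- (Hpt (ln 2)).
  assert (Hphi : forall t, 0 <= t -> 0 < exp (- (1 / 2 * ln (1 + t))) <= 1).
  { intros t Ht. split. apply exp_pos.
    assert (0 <= ln (1 + t)) by (rewrite <- ln_1; apply ln_le; lra).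
    apply Rle_trans with (exp 0); [apply exp_le; lra | rewrite exp_0; lra]. }
  apply Rle_trans with (-2 * M * exp (- (1 / 2 * ln (1 + x))) - -2 * M * exp (- (1 / 2 * ln (1 + ln 2)))).
  - apply (increment_le_along_line (fun s => H (unzeta s)) (fun s => f (unzeta s) * weight s)%C Ci 1 (fun t => -2 * M * exp (- (1 / 2 * ln (1 + t))))
      (fun t => M * exp (- (3 / 2 * ln (1 + t))))); trivial.
    + intros t Ht. rewrite Hpt. apply is_Cderive_pullback; trivial; simpl.
      * pose proof PI2_3_2. lra.
      * pose proof cos_1_gt_half.
        assert (He : 2 <= exp t). { rewrite <- (exp_ln 2) by lra. apply exp_le. lra. }
        nra.
    + intros t Ht. auto_derive. lra.
      replace (- (3 / 2 * ln (1 + t))) with (- (1 / 2 * ln (1 + t)) + - ln (1 + t)) by field.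
      rewrite exp_plus, (exp_Ropp (ln (1 + t))), exp_ln by lra. field. lra.
    + intros t Ht. rewrite Hpt. rewrite !Cmod_mult, Cmod_1, Rmult_1_r.
      apply Rmult_le_compat; try apply Cmod_ge_0.
      * apply HM, unit_disk_unzeta. simpl. pose proof cos_1_gt_half.
        assert (He : 2 <= exp t). { rewrite <- (exp_ln 2) by lra. apply exp_le. lra. }
        nra.
      * apply Cmod_weight_upper. lra.
  - pose proof (Hphi x ltac:(lra)). pose proof (Hphi (ln 2) ltac:(lra)). nra.
Qed.

(** The distinction between |1 + w| >= 1 and |1 + w| < 1 is needed since the
    detour through Im = 1 would leave the image of the disk for Re zeta(w)
    small.  Vertical moves have length at most 1 and 1 + pi/2 <= 3, which gives
    4 e, and the horizontal one gives 2. *)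
Lemma Cmod_segment_integral_le (f : C -> C) (M : R) (w : C) :
  analytic_on_disk f -> (forall z, unit_disk z -> Cmod (f z) <= M) -> unit_disk w ->
  Cmod (segment_integral (fun z => f z * gprime z)%C w) <= (4 * exp 1 + 2) * M.
Proof.
  intros Hf HM Hw.
  assert (D0 : unit_disk 0) by (unfold unit_disk; rewrite Cmod_0; lra).
  assert (HM0 : 0 <= M) by (eapply Rle_trans; [apply Cmod_ge_0 | apply (HM 0 D0)]).
  set (h := (fun z => f z * gprime z)%C).
  assert (Hh : analytic_on_disk h).
  { intros z Hz. apply ex_Cderive_mult; [now apply Hf | now apply analytic_gprime]. }
  pose proof (analytic_continuous h Hh) as Ch.
  pose proof (exp_pos 1) as He.
  assert (Hgp : forall z, unit_disk z -> Cmod (weight (zeta z)) <= exp 1).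
  { intros z Hz. destruct (zeta_range z Hz) as [H1 H2]. pose proof PI_4.
    rewrite (surjective_pairing (zeta z)). unfold Re, Im in *. apply Cmod_weight_le; lra. }
  destruct (Rle_or_lt 1 (Cmod (1 + w))) as [Hfar | Hnear].
  - rewrite segment_integral_seg_int.
    (* 1 <= |1 + w|^2 = 1 + 2 Re w + |w|^2 with |w| < 1; then |1 + s w| > 1/2. *)
    assert (Hre : - (1 / 2) < Re w).
    { assert (E : Cmod (1 + w) ^ 2 = 1 + 2 * Re w + Cmod w ^ 2).
      { rewrite !Cmod2_alt. destruct w as [u v]. simpl. ring. }
      unfold unit_disk in Hw. pose proof (Cmod_ge_0 w).
      assert (1 * 1 <= Cmod (1 + w) * Cmod (1 + w)) by (apply Rmult_le_compat; lra).
      assert (Cmod w * Cmod w <= Cmod w * 1) by (apply Rmult_le_compat_l; lra).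
      simpl in E. lra. }
    apply Rle_trans with (M * (exp 1 * 2) * Cmod (w - 0)).
    + apply Cmod_seg_int_le; trivial. intros s Hs.
      pose proof (unit_disk_convex 0 w s Hs D0 Hw) as Hz.
      assert (H1 : / 2 <= Cmod (1 + (0 + s * (w - 0)))).
      { eapply Rle_trans; [ | apply re_le_Cmod]. eapply Rle_trans; [ | apply Rle_abs].
        replace (0 + s * (w - 0))%C with (s * w)%C by ring.
        replace (Re (1 + s * w)) with (1 + s * Re w) by (unfold Re; simpl; ring). nra. }
      unfold h. rewrite Cmod_mult. apply Rmult_le_compat; try apply Cmod_ge_0.
      * now apply HM.
      * rewrite Cmod_gprime by trivial.
        apply Rmult_le_compat; [apply Cmod_ge_0 | | now apply Hgp | ].
        -- apply Rlt_le, Rinv_0_lt_compat. lra.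
        -- rewrite <- (Rinv_inv 2). apply Rinv_le_contravar; lra.
    + unfold unit_disk in Hw. replace (w - 0)%C with w by ring. pose proof (Cmod_ge_0 w).
      assert (0 <= M * exp 1) by (apply Rmult_le_pos; lra).
      assert (M * exp 1 * Cmod w <= M * exp 1 * 1) by (apply Rmult_le_compat_l; lra).
      lra.
  - set (H := segment_integral h).
    assert (HH : forall z, unit_disk z -> is_Cderive H z (f z * gprime z)%C).
    { intros z Hz. now apply (segment_integral_derive h z). }
    destruct (zeta_range w Hw) as [HX HY].
    pose proof (unzeta_zeta w Hw) as Ew.
    assert (Dw : 1 < exp (Re (zeta w)) * cos (Im (zeta w))).
    { apply unit_disk_unzeta. now rewrite Ew. }
    assert (HX2 : ln 2 <= Re (zeta w)).
    { change (Re (zeta w)) with (- ln (Cmod ((1 + w) / 2))).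
      destruct (unit_disk_right_half w Hw) as [Hv _].
      pose proof (re_le_Cmod ((1 + w) / 2)). pose proof (Rle_abs (Re ((1 + w) / 2))).
      rewrite <- ln_Rinv by lra. apply ln_le; [lra | ].
      rewrite <- (Rinv_inv 2) at 1. apply Rinv_le_contravar; [lra | ].
      rewrite Cmod_div by apply C2_neq_0. rewrite Cmod_R, Rabs_pos_eq by lra. lra. }
    rewrite <- Ew. destruct (zeta w) as [x y]. simpl Re in *. simpl Im in *.
    pose proof cos_1_gt_half as Hcos. pose proof PI2_3_2 as HPI. pose proof PI_4 as HPI4.
    assert (Hl : 0 < ln 2) by (rewrite <- ln_1; apply ln_increasing; lra).
    assert (E2 : exp (ln 2) = 2) by (apply exp_ln; lra).
    assert (Hex : 2 <= exp x) by (rewrite <- E2; now apply exp_le).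
    assert (D1 : 1 < exp x * cos 1) by nra.
    assert (E0 : H (unzeta (ln 2, 0)) = 0).
    { replace (unzeta (ln 2, 0)) with (RtoC 0).
      - unfold H. rewrite segment_integral_seg_int.
        apply Cmod_eq_0, Rle_antisym; [ | apply Cmod_ge_0].
        replace 0 with (Cmod (h 0) * Cmod (0 - 0)) at 3.
        + apply Cmod_seg_int_le; trivial. intros s _.
          replace (0 + s * (0 - 0))%C with (RtoC 0) by ring. lra.
        + replace (0 - 0)%C with (RtoC 0) by ring. rewrite Cmod_0. ring.
      - unfold unzeta, Cexp. simpl. rewrite Ropp_0, cos_0, sin_0, exp_Ropp, E2.
        apply injective_projections; simpl; field. }
    assert (V1 : Cmod (H (unzeta (ln 2, 1)) - H (unzeta (ln 2, 0))) <= M * exp 1 * (1 - 0)).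
    { apply (vertical_bound f H M); trivial; rewrite ?E2, ?cos_0; lra. }
    assert (V2 : Cmod (H (unzeta (x, 1)) - H (unzeta (ln 2, 1))) <= 2 * M).
    { now apply (horizontal_bound f H M). }
    assert (V3 : Cmod (H (unzeta (x, y)) - H (unzeta (x, 1))) <= M * exp 1 * 3).
    { assert (0 <= M * exp 1) by (apply Rmult_le_pos; lra).
      destruct (Rle_or_lt 1 y) as [H1y | Hy1].
      - eapply Rle_trans. apply (vertical_bound f H M); trivial; lra.
        apply Rmult_le_compat_l; lra.
      - replace (H (unzeta (x, y)) - H (unzeta (x, 1)))%C
          with (- (H (unzeta (x, 1)) - H (unzeta (x, y))))%C by ring.
        rewrite Cmod_opp.
        eapply Rle_trans. apply (vertical_bound f H M); trivial; lra.
        apply Rmult_le_compat_l; lra. }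
    replace (H (unzeta (x, y))) with
      ((H (unzeta (x, y)) - H (unzeta (x, 1))) + (H (unzeta (x, 1)) - H (unzeta (ln 2, 1)))
       + (H (unzeta (ln 2, 1)) - H (unzeta (ln 2, 0))))%C by (rewrite E0; ring).
    eapply Rle_trans; [apply Cmod_triangle | ].
    pose proof (Cmod_triangle (H (unzeta (x, y)) - H (unzeta (x, 1)))
      (H (unzeta (x, 1)) - H (unzeta (ln 2, 1)))). lra.
Qed.

Lemma T_bounded (g : C -> C) :
  (forall z, unit_disk z -> C_derive g z = gprime z) -> T_bounded_on_H_infty g.
Proof.
  intros Hg. exists (4 * exp 1 + 2). intros f [Hf [B HB]].
  assert (D0 : unit_disk 0) by (unfold unit_disk; rewrite Cmod_0; lra).
  unfold sup_norm at 2.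
  destruct (Lub_Rbar_correct (fun r : R => exists z : C, unit_disk z /\ r = Cmod (f z))) as [Hub Hlub].
  set (s := Lub_Rbar _) in *. clearbody s.
  (* Boundedness of f makes the supremum a real number. *)
  assert (Hf0 : Rbar_le (Cmod (f 0)) s) by (apply Hub; now exists (RtoC 0)).
  assert (HsB : Rbar_le s B).
  { apply Hlub. intros r [z [Hz ->]]. now apply HB. }
  destruct s as [s | | ]; simpl in Hf0, HsB; try contradiction.
  assert (HM : forall z, unit_disk z -> Cmod (f z) <= s).
  { intros z Hz. apply (Hub (Cmod (f z))). now exists z. }
  apply Lub_Rbar_correct. intros r [w [Hw ->]]. simpl.
  replace (T g f w) with (segment_integral (fun z => f z * gprime z)%C w).
  { now apply Cmod_segment_integral_le. }
  unfold T. rewrite !segment_integral_seg_int. unfold seg_int.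
  apply (RInt_ext (V := C_R_CompleteNormedModule)). intros t.
  rewrite Rmin_left, Rmax_right by lra. intros Ht.
  rewrite Hg; trivial. apply unit_disk_convex; trivial. lra.
Qed.

(** * Divergence along the radius *)

Lemma Cmod_gprime_real (x : R) : -1 < x <= 0 ->
  Cmod (gprime x) = / (1 + (ln 2 - ln (1 + x))) * / (1 + x).
Proof.
  intros Hx.
  assert (Hz : unit_disk x) by (unfold unit_disk; rewrite Cmod_R; apply Rabs_def1; lra).
  rewrite Cmod_gprime by trivial. 
  assert (E1 : (1 + x = RtoC (1 + x))%C) by (now rewrite RtoC_plus).
  rewrite E1, Cmod_R, Rabs_pos_eq by lra.
  assert (E : zeta x = RtoC (ln 2 - ln (1 + x))).
  { unfold zeta. rewrite E1.
    replace (RtoC (1 + x) / 2)%C with (RtoC ((1 + x) / 2)).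
    - unfold Clog. rewrite Cmod_R, Rabs_pos_eq by lra. 
      replace (Im (RtoC ((1 + x) / 2)) / Re (RtoC ((1 + x) / 2))) with 0 by (simpl; field; lra).
      rewrite atan_0, ln_div by lra.
      apply injective_projections; simpl; ring.
    - now rewrite RtoC_div. }
  rewrite E, Cmod_weight_real. reflexivity.
  assert (ln (1 + x) <= ln 2) by (apply ln_le; lra). lra.
Qed.

(** On the radius |g'| is the derivative of - ln (1 + ln (2 / (1 + x))), which
    tends to -oo at -1. *)
Lemma radial_integral_infinite (g : C -> C) :
  (forall z, unit_disk z -> C_derive g z = gprime z) ->
  integral_m1_0_infinite (fun x : R => Cmod (C_derive g (RtoC x))).
Proof.
  intros Hg. set (phi := fun x => - ln (1 + (ln 2 - ln (1 + x)))).
  assert (Hln : forall x, -1 < x <= 0 -> 0 <= ln 2 - ln (1 + x)).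
  { intros x Hx. assert (ln (1 + x) <= ln 2) by (apply ln_le; lra). lra. }
  assert (HI : forall r, -1 < r < 0 ->
    RInt (fun x : R => Cmod (C_derive g (RtoC x))) r 0 = phi 0 - phi r).
  { intros r Hr. apply is_RInt_unique.
    apply (is_RInt_ext (fun x => / (1 + (ln 2 - ln (1 + x))) * / (1 + x))).
    - intros x. rewrite Rmin_left, Rmax_right by lra. intros Hx.
      rewrite Hg by (unfold unit_disk; rewrite Cmod_R; apply Rabs_def1; lra).
      symmetry. apply Cmod_gprime_real. lra.
    - apply (is_RInt_derive (V := R_CompleteNormedModule) phi).
      + intros x. rewrite Rmin_left, Rmax_right by lra. intros Hx.
        pose proof (Hln x ltac:(lra)). unfold phi. auto_derive; [lra | field; lra].
      + intros x. rewrite Rmin_left, Rmax_right by lra. intros Hx.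
        pose proof (Hln x ltac:(lra)).
        apply (ex_derive_continuous (V := R_NormedModule)). auto_derive; lra. }
  unfold integral_m1_0_infinite.
  apply (filterlim_ext_loc (fun r => phi 0 - phi r)).
  { exists (mkposreal 1 Rlt_0_1). intros r Hr Hr1. symmetry. apply HI.
    change (Rabs (r - -1) < 1) in Hr. apply Rabs_def2 in Hr. lra. }
  intros P [B HB].
  (* Below this distance from -1, ln (1 + r) < - exp (B - phi 0). *)
  set (e := exp (- exp (B - phi 0))).
  assert (He : 0 < e) by apply exp_pos.
  exists (mkposreal _ (Rmin_pos _ _ He Rlt_0_1)). intros r Hr Hr1. apply HB.
  change (Rabs (r - -1) < Rmin e 1) in Hr. apply Rabs_def2 in Hr. destruct Hr as [Hr _].
  pose proof (Rmin_l e 1). pose proof (Rmin_r e 1).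
  assert (L1 : ln (1 + r) < - exp (B - phi 0)).
  { unfold e in *. rewrite <- (ln_exp (- exp (B - phi 0))). apply ln_increasing; lra. }
  assert (Hl : 0 < ln 2) by (rewrite <- ln_1; apply ln_increasing; lra).
  assert (L2 : B - phi 0 < ln (1 + (ln 2 - ln (1 + r)))).
  { rewrite <- (ln_exp (B - phi 0)) at 1. apply ln_increasing; [apply exp_pos | lra]. }
  unfold phi at 2. lra.
Qed.

Theorem proposition4p1 :
  exists g : C -> C,
    analytic_on_disk g /\
    T_bounded_on_H_infty g /\
    integral_m1_0_infinite (fun x : R => Cmod (C_derive g (RtoC x))).
Proof.
  exists (segment_integral gprime).
  assert (Hd : forall z, unit_disk z ->
    is_Cderive (segment_integral gprime) z (gprime z)).
  { intros z Hz. apply segment_integral_derive; trivial. apply analytic_gprime. }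
  assert (Hg : forall z, unit_disk z -> C_derive (segment_integral gprime) z = gprime z).
  { intros z Hz. now apply is_C_derive_unique, Hd. }
  split; [ | split].
  - intros z Hz. exists (gprime z). now apply Hd.
  - now apply T_bounded.
  - now apply radial_integral_infinite.
Qed.
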